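(* Let $f(z)=\sum_{n=0}^\infty a_n z^n$ be a non-constant entire function and let $(X_n)_{n\geq 0}$ be an independent centred subgaussian sequence of (real or complex) random variables. Then $\sum_{n=0}^\infty a_n X_n z^n$ defines almost surely an entire function. Moreover, for every $\delta>0$ there exist a (deterministic) set $E\subset[0,\infty)$ of finite logarithmic measure and a (deterministic) constant $C>0$ such that, almost surely, there exists $r_0>0$ such that $$\max_{|z|=r}\Big|\sum_{n=0}^\infty a_nX_nz^n\Big|\leq C\,\mu_f(r)\big(\log\mu_f(r)\big)^{\frac14}\big(\log\log\mu_f(r)\big)^{1+\delta}$$ for every $r\geq r_0$ with $r\notin E$.
   Context: All random variables are real or complex valued and defined on a probability space $(\Omega,\mathcal A,\mathbb P)$. A random variable $X$ is subgaussian if there are constants $K,\tau>0$ with $\mathbb P(|X|>t)\leq Ke^{-t^2/\tau^2}$ for all $t\geq 0$. A sequence $(X_n)_{n\ge 0}$ is subgaussian if every $X_n$ is subgaussian with the same constants $K,\tau$; it is centred if $\mathbb E(X_n)=0$ for all $n$; it is independent if the $X_n$ are independent. For $f(z)=\sum_{n=0}^\infty a_nz^n$, the maximum term is $\mu_f(r)=\max_{n\geq 0}|a_n|r^n$. A measurable set $E\subset[0,\infty)$ is of finite logarithmic measure if $\int_{E\cap[1,\infty)}\frac1r\,dr<\infty$. The number $r_0$ may depend on $\omega\in\Omega$, whereas $E$ and $C$ do not. *)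

(* Defs.v *)
From HB Require Import structures.
From mathcomp Require Import all_boot all_order all_algebra.
From mathcomp Require Export finmap complex.
From mathcomp Require Export all_classical all_reals all_analysis.
Import Order.TTheory GRing.Theory Num.Theory.
Export numFieldNormedType.Exports.

Set Implicit Arguments.
Unset Strict Implicit.
Unset Printing Implicit Defensive.

Local Open Scope classical_set_scope.
Local Open Scope ring_scope.

(* R[i] seen as a numClosedFieldType, so that it inherits the topology and the
   normed module structure (over itself) that every numFieldType has; nothing is
   declared in the libraries for R[i] itself. *)
Definition complex_field (R : realType) : numClosedFieldType := R[i].
Arguments complex_field : simpl never.

(* The real-valued modulus: the norm `|z| is a nonnegative element of R[i]. *)
Notation modulus := ComplexField.Normc.normc (only parsing).

Section EntireFunctions.
Context {R : realType}.
Local Notation C := (complex_field R).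
Implicit Types (a : nat -> C) (g : C -> C) (r : R) (z : C).

(* Complex differentiable everywhere: in 'derivable g z 1' the increments are
   scalars of the base field R[i]. *)
Definition entire g := forall z, derivable g z 1.

Definition power_series a z : nat -> C := series (fun n => a n * z ^+ n).

Definition power_series_sum a z : C := limn (power_series a z).

Definition defines_entire a :=
  (forall z, cvgn (power_series a z)) /\ entire (power_series_sum a).

(* For defines_entire a and r >= 0, the sets below are bounded and their suprema
   are attained, so that sup is max. *)
Definition maximum_term a r : R :=
  sup (range (fun n => modulus (a n) * r ^+ n)).

Definition maximum_modulus g r : R :=
  sup [set modulus (g z) | z in [set z | modulus z = r]].

End EntireFunctions.

Section ComplexRandomVariables.
Context {d : measure_display} {T : measurableType d} {R : realType}.
Local Notation C := (complex_field R).
Variable P : probability T R.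
Implicit Types (X : T -> C) (Y : nat -> T -> C).

Definition borel_complex : set (set C) := <<s [set U | open U] >>.

Definition complex_random_variable X :=
  forall B, borel_complex B -> measurable (X @^-1` B).

Definition subgaussian_seq Y :=
  exists K tau : R, [/\ 0 < K, 0 < tau &
    forall (n : nat) (t : R), 0 <= t ->
      (P [set w | (t < modulus (Y n w))%R]
        <= (K * expR (- (t ^+ 2 / tau ^+ 2)))%:E)%E].

Definition centred_seq Y := forall n,
  ('E_P[fun w => complex.Re (Y n w)] = 0 /\
   'E_P[fun w => complex.Im (Y n w)] = 0)%E.

Definition independent_seq Y :=
  forall (J : {fset nat}) (B : nat -> set C),
    (forall j, j \in J -> borel_complex (B j)) ->
    (P (\bigcap_(j in [set` J]) (Y j @^-1` B j)) =
     \prod_(j <- J) P (Y j @^-1` B j))%E.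

End ComplexRandomVariables.

Definition finite_logarithmic_measure {R : realType} (E : set R) :=
  (\int[lebesgue_measure]_(r in E `&` `[1%R, +oo[) (r^-1)%:E < +oo)%E.

(* Main.v *)
From mathcomp Require Import all_boot all_order all_algebra ring lra.
Require Import Defs.
From mathcomp Require Import measurable_realfun.
Import Order.TTheory GRing.Theory Num.Theory.

Set Implicit Arguments.
Unset Strict Implicit.
Unset Printing Implicit Defensive.

Local Open Scope classical_set_scope.
Local Open Scope ring_scope.

(** Write mu (e^x) = e^(g x); g is convex, because mu is a supremum of monomials.
    Cut the x-axis into levels e^k <= g < e^(k+1), on which the step
    h = (e^(k/2) (k+1)^(1+2 delta))^-1 is used. Discarding the x where the
    second difference of g with step h exceeds 1, or where its increment exceeds
    e^(k/2), costs a total length of order (k+1)^-(1+2 delta), which is summable: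
    this is E. At the remaining radii the terms |a_n| r^n / mu (r) decay
    geometrically on both sides of the central index, so that
    sum |a_n|^2 r^(2n) <= C mu^2 / h and sum n^2 |a_n| r^n <= C (e^(k/2) / h)^3 mu.
    For fixed z, a Chernoff bound controls the random sum by sqrt k times the
    square root of the variance with probability 1 - e^(-c k), and a union bound
    together with Borel-Cantelli extends this to a polar net of e^(O(k)) points in
    the disc of level k; the second estimate passes from the net to all z. Finally
    e^(k/4) and (k+1)^(1/2 + delta) come from the variance, and sqrt k from the
    union bound. *)

(** The set E must be fixed before the randomness, hence from the |a_n| alone, while the radii are
    uncountable. Randomness therefore enters through one event per level, which controls a truncated
    sum on a net of the whole disc and so serves all radii of that level. The power e^(k/2) is the
    balance point of a count: below e^(k+1), g has at most about e^(k+1) / D grid increments larger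
    than D, and an increment capped at D + 1 can rise by more than 1 only O(D) times; D = e^(k/2)
    makes both counts O(e^(k/2)). Since the variance is O(mu^2 / h), half of this exponent becomes
    the 1/4 of the theorem. Almost surely |X_n| <= Cw (n + 1) with a random Cw. It enters only the
    truncation and discretisation errors, which are O(mu) and lack the factor e^(k/4); at high
    levels this factor swallows Cw, and the final constant stays deterministic. *)

(** * The real modulus, and convergence in R[i] through it *)

Section Modulus.
Context {R : realType}.
Local Notation C := (complex_field R).
Implicit Types (z w : C) (u : nat -> C).

Definition to_complex (x : R) : C := (x%:C)%C.

Lemma norm_modulus z : `|z| = to_complex (modulus z).
Proof. by []. Qed.

Lemma ler_to_complex (x y : R) : (to_complex x <= to_complex y) = (x <= y).
Proof. exact: lecR. Qed.

Lemma ltr_to_complex (x y : R) : (to_complex x < to_complex y) = (x < y).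
Proof. exact: ltcR. Qed.

Lemma modulus_ge0 z : 0 <= modulus z.
Proof. by rewrite -ler_to_complex -norm_modulus normr_ge0. Qed.

Lemma modulus_triangle z w : modulus (z + w) <= modulus z + modulus w.
Proof. exact: le_normcD. Qed.

Lemma modulusN z : modulus (- z) = modulus z.
Proof. by case: z => x y /=; rewrite !sqrrN. Qed.

Lemma modulusB z w : modulus (z - w) = modulus (w - z).
Proof. by rewrite -modulusN opprB. Qed.

Lemma modulusM z w : modulus (z * w) = modulus z * modulus w.
Proof. exact: ComplexField.Normc.normcM. Qed.

Lemma modulus0 : modulus (0 : C) = 0.
Proof. exact: ComplexField.Normc.normc0. Qed.

Lemma modulus1 : modulus (1 : C) = 1.
Proof. exact: ComplexField.Normc.normc1. Qed.

Lemma modulusX z n : modulus (z ^+ n) = modulus z ^+ n.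
Proof.
by elim: n => [|n IH]; rewrite ?expr0 ?modulus1// !exprS modulusM IH.
Qed.

Lemma modulus_sum (N : nat) u :
  modulus (\sum_(0 <= n < N) u n) <= \sum_(0 <= n < N) modulus (u n).
Proof.
elim: N => [|N IH]; first by rewrite !big_geq ?modulus0.
rewrite !big_nat_recr//=; apply: le_trans (modulus_triangle _ _) _.
by rewrite lerD2r.
Qed.

Lemma modulus_to_complex (x : R) : modulus (to_complex x) = `|x|.
Proof.
by apply: complexI; rewrite -[LHS]/(`|(x%:C)%C|) normc_def /= expr0n addr0 sqrtr_sqr.
Qed.

(** The radii of balls in [C] are positive elements of R[i], hence real; this turns every limit in
    [C] into a real one. *)
Lemma cvg_modulusP u (l : C) :
  u @ \oo --> l <-> (fun n => modulus (u n - l)) @ \oo --> (0 : R).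
Proof.
split.
- move=> /cvgrPdist_lt ul; apply/cvgrPdist_lt => e e0.
  have e0' : 0 < to_complex e by rewrite -[0]/(to_complex 0) ltr_to_complex.
  near=> n.
  rewrite sub0r normrN ger0_norm ?modulus_ge0// modulusB -ltr_to_complex -norm_modulus.
  by near: n; apply: ul.
- move=> /cvgrPdist_lt ul; apply/cvgrPdist_lt => e e0.
  have eE : e = to_complex (complex.Re e).
    by rewrite /to_complex RRe_real// gtr0_real.
  move: e0; rewrite eE -[0]/(to_complex 0) ltr_to_complex => e0.
  near=> n.
  rewrite norm_modulus ltr_to_complex.
  have: `|0 - modulus (u n - l)| < complex.Re e by near: n; exact: ul.
  by rewrite sub0r normrN ger0_norm ?modulus_ge0// modulusB.
Unshelve. all: end_near. Qed.

Lemma cvg_modulus_le u (l : C) (K : R) :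
  u @ \oo --> l -> (\forall n \near \oo, modulus (u n) <= K) -> modulus l <= K.
Proof.
move=> /cvg_modulusP ul uK; rewrite -[K]addr0.
apply/ler_addgt0Pr => e e0.
move/cvgrPdist_lt : ul => /(_ _ e0) ul.
have [n [unK une]] := filter_ex (filterI uK ul).
have -> : l = u n - (u n - l) by ring.
apply: le_trans (modulus_triangle _ _) _; rewrite modulusN addr0.
apply: lerD => //; apply: ltW; move: une.
by rewrite sub0r normrN ger0_norm// modulus_ge0.
Qed.

Lemma modulus_le_ReIm z : modulus z <= `|complex.Re z| + `|complex.Im z|.
Proof.
case: z => x y /=.
rewrite -[leRHS]ger0_norm ?addr_ge0// -sqrtr_sqr ler_wsqrtr//.
by rewrite sqrrD !real_normK ?num_real// lerD2r lerDl mulrn_wge0// mulr_ge0.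
Qed.

Lemma normr_Re_le z : `|complex.Re z| <= modulus z.
Proof.
case: z => x y /=.
by rewrite -sqrtr_sqr ler_wsqrtr// lerDl sqr_ge0.
Qed.

Lemma normr_Im_le z : `|complex.Im z| <= modulus z.
Proof.
case: z => x y /=.
by rewrite -sqrtr_sqr ler_wsqrtr// lerDr sqr_ge0.
Qed.

Lemma bounded_series_cvg (t : nat -> R) (K : R) :
  (forall n, 0 <= t n) -> (forall N, \sum_(0 <= n < N) t n <= K) -> cvgn (series t).
Proof.
move=> t0 tK; apply: nondecreasing_is_cvgn.
  by apply: nondecreasing_series => n _ _; exact: t0.
by exists K => _ [N _ <-]; exact: tK.
Qed.

Lemma Re_sum u N :
  complex.Re (\sum_(0 <= n < N) u n) = \sum_(0 <= n < N) complex.Re (u n).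
Proof.
elim: N => [|N IH]; first by rewrite !big_geq.
by rewrite !big_nat_recr//= -IH; case: (\sum_(_ <= _ < _) _) (u N) => ? ? [].
Qed.

Lemma Im_sum u N :
  complex.Im (\sum_(0 <= n < N) u n) = \sum_(0 <= n < N) complex.Im (u n).
Proof.
elim: N => [|N IH]; first by rewrite !big_geq.
by rewrite !big_nat_recr//= -IH; case: (\sum_(_ <= _ < _) _) (u N) => ? ? [].
Qed.

(** Real and imaginary parts are absolutely convergent real series, and the limit is assembled from
    theirs. *)
Lemma summable_cvg u (K : R) :
  (forall N, \sum_(0 <= n < N) modulus (u n) <= K) -> cvgn (series u).
Proof.
move=> uK.
have part (f : C -> R) : (forall z, `|f z| <= modulus z) ->
    cvgn (series (fun n => f (u n))).
  move=> fle; apply: normed_cvg.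
  apply: (@bounded_series_cvg _ K) => [n|N]; first exact: normr_ge0.
  by apply: le_trans (uK N); apply: ler_sum => n _; exact: fle.
have cRe := part _ normr_Re_le; have cIm := part _ normr_Im_le.
set x := limn (series (fun n => complex.Re (u n))) in cRe *.
set y := limn (series (fun n => complex.Im (u n))) in cIm *.
apply/cvg_ex; exists ((x +i* y)%C : C); apply/cvg_modulusP.
have cR : (fun n => `|series (fun n => complex.Re (u n)) n - x|
                  + `|series (fun n => complex.Im (u n)) n - y|) @ \oo --> (0 : R).
  rewrite -[0]addr0; apply: cvgD; apply/norm_cvg0P.
    rewrite -(subrr x); apply: cvgB; [exact: cRe|exact: cvg_cst].
  rewrite -(subrr y); apply: cvgB; [exact: cIm|exact: cvg_cst].
apply: (squeeze_cvgr _ (cvg_cst _) cR).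
apply: nearW => N; rewrite modulus_ge0 /=.
apply: le_trans (modulus_le_ReIm _) _; rewrite /series/= -Re_sum -Im_sum.
by case: (\sum_(_ <= _ < _) _).
Qed.

Lemma series_tail u N (K : R) : cvgn (series u) ->
  (forall M, \sum_(N <= n < M) modulus (u n) <= K) ->
  modulus (limn (series u) - series u N) <= K.
Proof.
move=> cu uK; apply: (@cvg_modulus_le (fun n => series u n - series u N)).
  by apply: cvgB; [exact: cu|exact: cvg_cst].
exists N => // M /= NM; apply: le_trans (uK M).
rewrite sub_series_geq//.
rewrite -{1}[N]add0n big_addn [leRHS](_ : _ = \sum_(0 <= n < M - N) modulus (u (n + N)%N)).
  exact: modulus_sum.
by rewrite -{1}[N]add0n big_addn.
Qed.

End Modulus.

(** * Power series with infinite radius of convergence *)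

Section PowerSeries.
Context {R : realType}.
Local Notation C := (complex_field R).
Implicit Types (z w : C) (b : nat -> C).

(* The infinite radius of convergence, for the moduli of the coefficients. *)
Definition fast_decay (A : nat -> R) :=
  forall r : R, 0 <= r -> exists B : R, forall n, A n * r ^+ n <= B.

Lemma sum_half_pow N : \sum_(0 <= n < N) ((2^-1 : R) ^+ n) <= 2.
Proof.
suff -> : \sum_(0 <= n < N) ((2^-1 : R) ^+ n) = 2 - 2 * 2^-1 ^+ N.
  by rewrite lerBlDr lerDl mulr_ge0// exprn_ge0// invr_ge0.
elim: N => [|N IH]; first by rewrite big_geq// expr0; ring.
by rewrite big_nat_recr//= IH exprS; field.
Qed.

(** The terms are bounded at the larger radius 2^(p+1) r. As n + 1 <= 2^n, the part 2^(pn) of the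
    gain absorbs (n + 1)^p, and the remaining 2^n leaves a geometric series. *)
Lemma fast_decay_moment (A : nat -> R) (p : nat) (r : R) :
  (forall n, 0 <= A n) -> fast_decay A -> 0 <= r ->
  exists2 K : R, 0 <= K &
    forall N, \sum_(0 <= n < N) (n.+1%:R ^+ p * A n * r ^+ n) <= K.
Proof.
move=> A0 Adec r0.
have [|B AB] := Adec (2 ^+ p.+1 * r); first by rewrite mulr_ge0// exprn_ge0.
have B0 : 0 <= B by apply: le_trans (AB 0%N); rewrite expr0 mulr1.
exists (B * 2) => [|N]; first by rewrite mulr_ge0.
apply: (@le_trans _ _ (\sum_(0 <= n < N) (B * 2^-1 ^+ n))); last first.
  by rewrite -mulr_sumr ler_wpM2l// sum_half_pow.
apply: ler_sum => n _.
have -> : B * 2^-1 ^+ n = B / 2 ^+ n by rewrite exprVn.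
rewrite ler_pdivlMr ?exprn_gt0//; apply: le_trans (AB n).
have -> : (2 ^+ p.+1 * r) ^+ n = (2 ^+ n) ^+ p * 2 ^+ n * r ^+ n.
  by rewrite exprMn -!exprM mulSn exprD mulnC [(2 ^+ n) * _]mulrC.
have -> : n.+1%:R ^+ p * A n * r ^+ n * 2 ^+ n = A n * (n.+1%:R ^+ p * 2 ^+ n * r ^+ n) by ring.
apply: ler_wpM2l => //; rewrite !ler_wpM2r ?exprn_ge0// lerXn2r ?nnegrE ?exprn_ge0//.
by rewrite -natrX ler_nat ltn_expl.
Qed.

(** The recursion behind the second-order Taylor remainder of z^n. At n = 0 the truncated exponent
    [n.-1] is harmless because of the factor n. *)
Fact taylor_rec (K : comNzRingType) (z h : K) n :
  (z + h) ^+ n.+1 - z ^+ n.+1 - n.+1%:R * z ^+ n.+1.-1 * h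
    = (z + h) * ((z + h) ^+ n - z ^+ n - n%:R * z ^+ n.-1 * h)
      + n%:R * z ^+ n.-1 * h ^+ 2.
Proof.
case: n => [|n]; first by rewrite /= !expr0 !expr1 mulr0n; ring.
by rewrite /= -[n.+2%:R]natr1 !exprS; ring.
Qed.

Lemma modulus_exprB z w (r : R) n : modulus z <= r -> modulus w <= r ->
  modulus (z ^+ n.+1 - w ^+ n.+1) <= n.+1%:R * r ^+ n * modulus (z - w).
Proof.
move=> zr wr; have r0 : 0 <= r := le_trans (modulus_ge0 _) zr.
elim: n => [|n IH]; first by rewrite !expr1 expr0 !mul1r.
have -> : z ^+ n.+2 - w ^+ n.+2 = z * (z ^+ n.+1 - w ^+ n.+1) + (z - w) * w ^+ n.+1.
  by rewrite !exprS; ring.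
apply: le_trans (modulus_triangle _ _) _; rewrite !modulusM modulusX.
have -> : n.+2%:R * r ^+ n.+1 * modulus (z - w) =
    r * (n.+1%:R * r ^+ n * modulus (z - w)) + modulus (z - w) * r ^+ n.+1.
  by rewrite -[n.+2]addn1 natrD exprS; ring.
apply: lerD; first by apply: ler_pM; rewrite ?modulus_ge0.
by rewrite ler_wpM2l ?modulus_ge0// lerXn2r ?nnegrE ?modulus_ge0.
Qed.

(** The sharp factor n (n - 1) / 2 r^(n-2) is relaxed to n^2 r^n, which the recursion sustains since
    n^2 + n <= (n + 1)^2; 1 <= r allows powers of r to be raised. *)
Lemma modulus_expr_taylor z h (r : R) n :
  modulus z <= r -> modulus (z + h) <= r -> 1 <= r ->
  modulus ((z + h) ^+ n - z ^+ n - n%:R * z ^+ n.-1 * h)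
    <= n%:R ^+ 2 * r ^+ n * modulus h ^+ 2.
Proof.
move=> zr wr r1; have r0 : 0 <= r := le_trans ler01 r1.
elim: n => [|n IH]; first by rewrite !expr0 subrr !mul0r subr0 modulus0 expr0n !mul0r.
rewrite (taylor_rec (K := C)).
apply: le_trans (modulus_triangle _ _) _; rewrite !modulusM !modulusX.
have -> : modulus (n%:R : C) = n%:R.
  by rewrite -[RHS]normr_nat -modulus_to_complex /to_complex rmorph_nat.
apply: (@le_trans _ _ (r * (n%:R ^+ 2 * r ^+ n * modulus h ^+ 2)
   + n%:R * r ^+ n.+1 * modulus h ^+ 2)).
  apply: lerD; first by apply: ler_pM; rewrite ?modulus_ge0.
    rewrite -expr2 ler_wpM2r ?exprn_ge0 ?modulus_ge0// ler_wpM2l//.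
  apply: (@le_trans _ _ (r ^+ n.-1)); first by rewrite lerXn2r ?nnegrE ?modulus_ge0.
  by apply: ler_weXn2l => //; exact: leq_trans (leq_pred _) _.
have -> : r * (n%:R ^+ 2 * r ^+ n * modulus h ^+ 2)
   + n%:R * r ^+ n.+1 * modulus h ^+ 2
   = (n%:R ^+ 2 + n%:R) * r ^+ n.+1 * modulus h ^+ 2 by rewrite [r ^+ n.+1]exprS; ring.
rewrite !ler_wpM2r ?exprn_ge0 ?modulus_ge0//.
rewrite -[n.+1]addn1 natrD; have := ler0n R n; nra.
Qed.

Lemma fast_decay_cvg b z : fast_decay (fun n => modulus (b n)) ->
  cvgn (power_series b z).
Proof.
move=> bdec.
have [|||K _ Kle] := @fast_decay_moment (fun n => modulus (b n)) 0 (modulus z).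
- by move=> n; exact: modulus_ge0.
- exact: bdec.
- exact: modulus_ge0.
apply: (@summable_cvg _ _ K) => N; apply: le_trans (Kle N).
by apply: ler_sum => n _; rewrite modulusM modulusX expr0 mul1r.
Qed.

Lemma fast_decay_derivable b z : fast_decay (fun n => modulus (b n)) ->
  derivable (power_series_sum b) z 1.
Proof.
(* The disc of radius |z| + 1 contains z and every z + h with |h| <= 1. *)
move=> bdec; pose r := modulus z + 1.
have r1 : 1 <= r by rewrite lerDr modulus_ge0.
have r0 : 0 <= r := le_trans ler01 r1.
have [|K K0 Kle] := @fast_decay_moment (fun n => modulus (b n)) 2 r _ bdec r0.
  by move=> n; exact: modulus_ge0.
pose b' n : C := n%:R * b n * z ^+ n.-1.
have modn n : modulus (n%:R : C) = n%:R.
  by rewrite -[RHS]normr_nat -modulus_to_complex /to_complex rmorph_nat.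
have cb' : cvgn (series b').
  apply: (@summable_cvg _ _ K) => N; apply: le_trans (Kle N).
  apply: ler_sum => n _; rewrite /b' !modulusM modulusX modn.
  apply: (@le_trans _ _ (n%:R * modulus (b n) * r ^+ n)).
    rewrite ler_wpM2l ?mulr_ge0 ?modulus_ge0//.
    apply: (@le_trans _ _ (r ^+ n.-1)).
      by rewrite lerXn2r ?nnegrE ?modulus_ge0// lerDl.
    by rewrite ler_weXn2l// leq_pred.
  rewrite ler_wpM2r ?exprn_ge0// ler_wpM2r ?modulus_ge0//.
  apply: (@le_trans _ _ n.+1%:R); first by rewrite ler_nat.
  by rewrite ler_eXnr// ler1n.
apply/cvg_ex; exists (limn (series b')).
(* The bound is proved for partial sums, uniformly in their length, and then passed to the limit;
   the second moment K dominates the sum of the Taylor remainders. *)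
have key (h : C) : h != 0 -> modulus h <= 1 ->
    modulus (limn (series b') - h^-1 * (power_series_sum b (h * 1 + z) - power_series_sum b z))
      <= K * modulus h.
  move=> h0 h1.
  have cz : cvgn (power_series b z) := fast_decay_cvg bdec.
  have czh : cvgn (power_series b (h * 1 + z)) := fast_decay_cvg bdec.
  apply: (@cvg_modulus_le _
    (fun N => series b' N
      - h^-1 * (power_series b (h * 1 + z) N - power_series b z N))).
    apply: cvgB; first exact: cb'.
    by apply: cvgM; [exact: cvg_cst|apply: cvgB; [exact: czh|exact: cz]].
  apply: nearW => N.
  have hM : modulus h != 0.
    by apply: contra_neq h0 => /ComplexField.Normc.eq0_normc.
  rewrite -(@ler_pM2r _ (modulus h)) ?lt_neqAle ?modulus_ge0 ?andbT 1?eq_sym// -modulusM.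
  rewrite /series /power_series /series /= -sumrB mulr_sumr -sumrB mulr_suml.
  apply: le_trans (modulus_sum _ _) _.
  rewrite -mulrA -expr2 -(mulrC (_ ^+ 2)).
  apply: le_trans (ler_wpM2l (exprn_ge0 2 (modulus_ge0 h)) (Kle N)).
  rewrite mulr_sumr; apply: ler_sum => n _.
  have -> : (b' n - h^-1 * (b n * (h * 1 + z) ^+ n - b n * z ^+ n)) * h
     = - (b n * ((z + h) ^+ n - z ^+ n - n%:R * z ^+ n.-1 * h)).
    rewrite /b' mulr1.
    rewrite [h + z]addrC mulrBl [h^-1 * _]mulrC -[X in _ - X]mulrA mulVf// mulr1.
    have gen (F : comNzRingType) (x y c p q t : F) :
        x * y * c * t - (y * p - y * q) = - (y * (p - q - x * c * t)) by ring.
    exact: (gen C).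
  rewrite modulusN modulusM.
  apply: (@le_trans _ _ (modulus (b n) * (n%:R ^+ 2 * r ^+ n * modulus h ^+ 2))).
    rewrite ler_wpM2l ?modulus_ge0// modulus_expr_taylor//.
      by rewrite lerDl.
    by apply: le_trans (modulus_triangle _ _) _; rewrite lerD2l.
  have -> : modulus (b n) * (n%:R ^+ 2 * r ^+ n * modulus h ^+ 2) =
     modulus h ^+ 2 * (n%:R ^+ 2 * modulus (b n) * r ^+ n) by ring.
  rewrite ler_wpM2l ?exprn_ge0 ?modulus_ge0// !ler_wpM2r ?exprn_ge0 ?modulus_ge0//.
  by rewrite lerXn2r ?nnegrE// ler_nat.
apply/cvgrPdist_lt => e e0.
have eE : e = to_complex (complex.Re e).
  by rewrite /to_complex RRe_real// gtr0_real.
move: e0; rewrite eE -[0]/(to_complex 0) ltr_to_complex => e0.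
pose m := Num.min 1 (complex.Re e / (K + 1)).
have K1 : 0 < K + 1 by rewrite ltr_wpDl.
have m0 : 0 < m by rewrite lt_min ltr01 divr_gt0.
apply/nbhs_ballP; exists (to_complex m) => /=.
  by rewrite -[0]/(to_complex 0) ltr_to_complex.
move=> h; rewrite /ball/= sub0r normrN norm_modulus ltr_to_complex lt_min => /andP[h1 hK] h0.
rewrite norm_modulus ltr_to_complex.
apply: le_lt_trans (key _ _ _) _ => //; first exact: ltW.
move: hK; rewrite ltr_pdivlMr// => hK; apply: le_lt_trans hK.
by rewrite mulrC ler_wpM2l ?modulus_ge0// lerDl.
Qed.

Lemma fast_decay_entire b : fast_decay (fun n => modulus (b n)) ->
  defines_entire b.
Proof.
by move=> bdec; split => z; [exact: fast_decay_cvg|exact: fast_decay_derivable].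
Qed.

(** At the real point r the terms of a convergent series tend to 0, so all but finitely many are
    below 1 in modulus; the others are covered by their sum. *)
Lemma entire_fast_decay b : defines_entire b -> fast_decay (fun n => modulus (b n)).
Proof.
move=> [bcvg _] r r0.
have := cvg_series_cvg_0 (bcvg (to_complex r)).
move=> /cvgrPdist_lt/(_ 1 ltr01) [N _ Nlt].
exists (1 + \sum_(0 <= n < N) (modulus (b n) * r ^+ n)) => n.
have s0 : 0 <= \sum_(0 <= n < N) (modulus (b n) * r ^+ n).
  by apply: sumr_ge0 => i _; rewrite mulr_ge0 ?modulus_ge0 ?exprn_ge0.
have [nN|Nn] := ltnP n N.
  apply: (@le_trans _ _ (\sum_(0 <= n < N) (modulus (b n) * r ^+ n))); last by rewrite lerDr.
  rewrite big_mkord (bigD1 (Ordinal nN))//= lerDl.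
  by apply: sumr_ge0 => i _; rewrite mulr_ge0 ?modulus_ge0 ?exprn_ge0.
apply: (@le_trans _ _ 1); last by rewrite lerDl.
have := Nlt n Nn.
rewrite sub0r normrN norm_modulus -[1]/(to_complex 1) ltr_to_complex modulusM modulusX.
by rewrite modulus_to_complex ger0_norm// => /ltW.
Qed.

(** This is how nonconstancy enters: the monomial of such an index makes log mu grow at least
    linearly in log r. *)
Lemma nonconstant_coef b :
  (~ exists c : C, forall z, power_series_sum b z = c) ->
  exists2 n, (0 < n)%N & 0 < modulus (b n).
Proof.
move=> bnc; apply: contrapT => bn; apply: bnc; exists (b 0%N) => z.
have b0 n : (0 < n)%N -> b n = 0.
  move=> n0; apply: ComplexField.Normc.eq0_normc; apply/eqP.
  rewrite eq_le modulus_ge0 andbT leNgt; apply/negP => bn0; apply: bn.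
  by exists n.
have E N : power_series b z N.+1 = b 0%N.
  elim: N => [|N IH]; first by rewrite /power_series /series/= big_nat1 expr0 mulr1.
  rewrite /power_series /series/= big_nat_recr//= b0// mul0r addr0.
  exact: IH.
apply: cvg_lim => //; rewrite -(cvg_shiftn 1).
apply: cvg_near_cst; apply: nearW => N; rewrite /= addn1; exact: E.
Qed.

End PowerSeries.

(** * Convexity of log mu in the variable x = log r *)

Section LogMaximumTerm.
Context {R : realType}.
Variables (A : nat -> R) (n0 : nat).
Hypotheses (A_ge0 : forall n, 0 <= A n) (A_decay : fast_decay A).
Hypotheses (n0_gt0 : (0 < n0)%N) (An0_gt0 : 0 < A n0).
Implicit Types (x y s : R) (n : nat).

(** In the variable x = log r; when A is the sequence of moduli of a, this is convertible with
    [maximum_term a (expR x)]. *)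
Definition max_term x := sup (range (fun n => A n * expR x ^+ n)).

Definition log_max_term x := ln (max_term x).

Local Notation mu := max_term.
Local Notation g := log_max_term.

Lemma max_term_ge n x : A n * expR x ^+ n <= mu x.
Proof.
apply: ub_le_sup; last by exists n.
have [B AB] := A_decay (expR_ge0 x).
by exists B => _ [m _ <-].
Qed.

Lemma max_term_le x (K : R) : (forall n, A n * expR x ^+ n <= K) -> mu x <= K.
Proof.
move=> AK; apply: ge_sup => [|_ [n _ <-]//].
by exists (A 0 * expR x ^+ 0), 0%N.
Qed.

Lemma max_term_gt0 x : 0 < mu x.
Proof.
by apply: lt_le_trans (max_term_ge n0 x); rewrite mulr_gt0// exprn_gt0// expR_gt0.
Qed.

Lemma max_termE x : mu x = expR (g x).
Proof. by rewrite lnK// posrE max_term_gt0. Qed.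

(* Compare the terms of indices n and m on the left with those of the same
   indices on the right, exchanging them when m < n. *)
Lemma max_term_log_convex x y s : 0 <= s -> x <= y ->
  mu (x + s) * mu y <= mu x * mu (y + s).
Proof.
move=> s0 xy.
have key n m : A n * expR (x + s) ^+ n * (A m * expR y ^+ m) <= mu x * mu (y + s).
  have e0 z : 0 <= expR z :> R := expR_ge0 z.
  have [mn|nm] := leqP m n.
    apply: (@le_trans _ _ (A m * expR x ^+ m * (A n * expR (y + s) ^+ n))).
      rewrite [leLHS](_ : _ = A n * A m * (expR (x + s) ^+ n * expR y ^+ m)); last by ring.
      rewrite [leRHS](_ : _ = A n * A m * (expR x ^+ m * expR (y + s) ^+ n)); last by ring.
      rewrite ler_wpM2l ?mulr_ge0// -!expRM_natl -!expRD ler_expR.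
      have : (m%:R : R) <= n%:R by rewrite ler_nat.
      nra.
    by apply: ler_pM; rewrite ?max_term_ge// mulr_ge0// exprn_ge0.
  apply: (@le_trans _ _ (A n * expR x ^+ n * (A m * expR (y + s) ^+ m))).
    rewrite [leLHS](_ : _ = A n * A m * (expR (x + s) ^+ n * expR y ^+ m)); last by ring.
    rewrite [leRHS](_ : _ = A n * A m * (expR x ^+ n * expR (y + s) ^+ m)); last by ring.
    rewrite ler_wpM2l ?mulr_ge0// -!expRM_natl -!expRD ler_expR.
    have : (n%:R : R) <= m%:R by rewrite ler_nat ltnW.
    nra.
  by apply: ler_pM; rewrite ?max_term_ge// mulr_ge0// exprn_ge0.
rewrite -ler_pdivlMr ?max_term_gt0//; apply: max_term_le => n.
rewrite ler_pdivlMr ?max_term_gt0//.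
have [An0|] := ltP 0 (A n * expR (x + s) ^+ n); last first.
  move=> An0; apply: (@le_trans _ _ 0); last by rewrite mulr_ge0// ltW// max_term_gt0.
  by apply: mulr_le0_ge0 => //; rewrite ltW// max_term_gt0.
rewrite mulrC -ler_pdivlMr//; apply: max_term_le => m.
by rewrite ler_pdivlMr// mulrC.
Qed.

Lemma log_max_term_increments x y s : 0 <= s -> x <= y ->
  g (x + s) - g x <= g (y + s) - g y.
Proof.
move=> s0 xy; have := max_term_log_convex s0 xy.
rewrite (max_termE (x + s)) (max_termE y) (max_termE x) (max_termE (y + s)).
move: (g (x + s)) (g y) (g x) (g (y + s)) => p q p' q'.
by rewrite -!expRD ler_expR => ?; lra.
Qed.

Lemma log_max_term_mono x y : x <= y -> g x <= g y.
Proof.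
move=> xy; rewrite ler_ln ?posrE ?max_term_gt0//.
apply: max_term_le => n; apply: le_trans (max_term_ge n y).
by rewrite ler_wpM2l// lerXn2r ?nnegrE ?expR_ge0// ler_expR.
Qed.

Lemma log_max_term_ge x : 0 <= x -> x + ln (A n0) <= g x.
Proof.
move=> x0; apply: (@le_trans _ _ (n0%:R * x + ln (A n0))).
  by rewrite lerD2r ler_peMl// ler1n.
rewrite -ler_expR expRD lnK ?posrE// -max_termE expRM_natl mulrC.
exact: max_term_ge.
Qed.

Lemma log_max_term_large (K : R) : exists2 x0, 0 <= x0 & K <= g x0.
Proof.
exists (Num.max 0 (K - ln (A n0))); first by rewrite le_max lexx.
apply: le_trans (log_max_term_ge _); last by rewrite le_max lexx.
by rewrite -lerBlDr le_max lexx orbT.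
Qed.

End LogMaximumTerm.

(** * Counting the bad steps of a convex sequence *)

Section BadSteps.
Context {R : realType}.
Implicit Types (G : nat -> R) (K D : R).

(* Off the bad steps with G i.+1 < K, the increment G i.+3 - G i.+2 is at most
   D + 1. Only the earlier increment is compared with D, because K does not
   control G beyond i.+1. *)
Definition bad_step G K D (i : nat) : bool :=
  (G i.+1 < K) &&
    ((D < G i.+1 - G i) || (1 < G i.+3 - G i.+2 - (G i.+1 - G i))).

(** A potential argument: each bad step raises the nondecreasing [Phi] by at least 1, and [Phi]
    stays between 0 and K / D + 2 (D + 1). *)
Lemma count_bad_step G K D (N : nat) :
  0 < D -> 0 <= G 0%N -> 0 <= K ->
  {homo G : i j / (i <= j)%N >-> i <= j} ->
  (forall i, G i.+1 - G i <= G i.+2 - G i.+1) ->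
  \sum_(0 <= i < N) (bad_step G K D i)%:R <= K / D + 2 * (D + 1).
Proof.
move=> D0 G0 K0 Gmono dmono.
pose d i := G i.+1 - G i.
have d0 i : 0 <= d i by rewrite subr_ge0 Gmono.
(* A jump compares slopes two steps apart; with two consecutive slopes in the sum, one step
   exchanges [d i] for [d i.+2]. The cap D + 1 still shows a rise by 1 when [d i] is at most D. *)
pose Phi i := Num.min (G i) K / D + Num.min (d i) (D + 1) + Num.min (d i.+1) (D + 1).
have step i : (bad_step G K D i)%:R <= Phi i.+1 - Phi i.
  have Gi : G i <= G i.+1 by exact: Gmono.
  have m1 : Num.min (G i) K / D <= Num.min (G i.+1) K / D.
    by rewrite ler_pM2r ?invr_gt0// le_min !ge_min Gi lexx orbT.
  have m2 : Num.min (d i) (D + 1) <= Num.min (d i.+2) (D + 1).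
    by rewrite le_min !ge_min lexx (le_trans (dmono i) (dmono i.+1)) orbT.
  rewrite /Phi /bad_step.
  case: (boolP (G i.+1 < K)) => [GK /=|_]; last by rewrite mulr0n; lra.
  case: (boolP (D < G i.+1 - G i)) => [Dd /=|]; last rewrite -leNgt => dD /=.
    suff : 1 <= Num.min (G i.+1) K / D - Num.min (G i) K / D by lra.
    rewrite (min_l (ltW GK)) (min_l (le_trans Gi (ltW GK))).
    by rewrite -mulrBl ler_pdivlMr// mul1r ltW.
  case: (boolP (1 < G i.+3 - G i.+2 - (G i.+1 - G i))) => [jump /=|_ /=]; last by rewrite mulr0n; lra.
  suff : 1 <= Num.min (d i.+2) (D + 1) - Num.min (d i) (D + 1) by lra.
  rewrite [X in _ - X]min_l; last by rewrite /d; lra.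
  by rewrite lerBrDl le_min /d; apply/andP; split; lra.
have tele : \sum_(0 <= i < N) (bad_step G K D i)%:R <= Phi N - Phi 0%N.
  rewrite -telescope_sumr//; exact: ler_sum.
apply: (le_trans tele).
have : Phi N <= K / D + (D + 1) + (D + 1).
  rewrite /Phi; apply: lerD; last by rewrite ge_min lexx orbT.
  apply: lerD; last by rewrite ge_min lexx orbT.
  by rewrite ler_pM2r ?invr_gt0// ge_min lexx orbT.
have : 0 <= Phi 0%N.
  have D1 : 0 <= D + 1 by lra.
  by rewrite /Phi !addr_ge0 ?divr_ge0 ?(ltW D0)// le_min ?G0 ?K0 ?d0.
lra.
Qed.

End BadSteps.

(** * Logarithmic measure of a union of cells *)

Section Cells.
Context {R : realType}.
Variables (bad : nat -> nat -> bool) (a b : nat -> nat -> R) (c : nat -> R) (K : R).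

Definition bad_cells : set R :=
  \bigcup_k \bigcup_(i in [set i | bad k i]) [set` `[a k i, b k i[ ].

Lemma measurable_bad_cells : measurable bad_cells.
Proof. by apply: bigcup_measurable => k _; apply: bigcup_measurable => i _. Qed.

(** On a cell the density 1/r is at most 1/a, so (b - a) / a bounds its logarithmic measure.
    Overlapping cells do no harm, as the series of step functions [F] merely counts them several
    times. *)
Lemma log_measure_bad_cells :
  (forall k i, 1 <= a k i) -> (forall k i, a k i <= b k i) ->
  (forall k N, \sum_(0 <= i < N) (bad k i)%:R * ((b k i - a k i) / a k i) <= c k) ->
  (forall N, \sum_(0 <= k < N) c k <= K) ->
  finite_logarithmic_measure bad_cells.
Proof.
move=> a1 ab sumc sumK.
have a0 k i : 0 < a k i := lt_le_trans ltr01 (a1 k i).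
pose D : set (measurableTypeR R) := bad_cells `&` [set` `[1%R, +oo[ ].
have mD : measurable D by apply: measurableI => //; exact: measurable_bad_cells.
pose F k i : measurableTypeR R -> \bar R := fun r => ((bad k i)%:R / a k i * \1_([set` `[a k i, b k i[ ]) r)%:E.
have F0 k i r : (0 <= F k i r)%E.
  by rewrite lee_fin mulr_ge0 ?divr_ge0 ?ler0n ?(ltW (a0 _ _))// indicE ler0n.
have mF k i : measurable_fun D (F k i).
  by apply/measurable_EFinP; exact: measurable_funM.
have mF' k : measurable_fun D (fun r => \sum_(i <oo) F k i r)%E.
  by apply: ge0_emeasurable_sum => // i r _ _; exact: F0.
have F0' k r : (0 <= \sum_(i <oo) F k i r)%E by apply: nneseries_ge0.
apply: (@le_lt_trans _ _ (\int[lebesgue_measure]_(r in D) \sum_(k <oo) \sum_(i <oo) F k i r)%E).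
  apply: ge0_le_integral => //.
  - by move=> r [_ /=]; rewrite in_itv/= andbT => r1; rewrite lee_fin invr_ge0 (le_trans ler01).
  - apply/measurable_EFinP.
    have mV : measurable_fun ([set` `]0%R, +oo[ ] : set R) (@GRing.inv R).
      apply: open_continuous_measurable_fun; first exact: interval_open.
      move=> r /set_mem/=; rewrite in_itv/= andbT => r0.
      by apply: inv_continuous; rewrite gt_eqF.
    apply: measurable_funS mV => //.
    by move=> r [_ /=]; rewrite !in_itv/= !andbT; apply: lt_le_trans.
  - by apply: ge0_emeasurable_sum => // k r _ _; exact: F0'.
  - move=> r [[k _ [i /= badki rki]] _].
    apply: (@le_trans _ _ (F k i r)).
      rewrite /F badki mul1r indicE mem_set// mulr1 lee_fin.
      move: rki; rewrite /= in_itv/= => /andP[ar _].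
      by rewrite lef_pV2 ?posrE// (lt_le_trans (a0 k i)).
    apply: (@le_trans _ _ (\sum_(i <oo) F k i r)%E).
      apply: le_trans (nneseries_lim_ge i.+1 _) => //.
      by rewrite big_nat_recr//= leeDr// sume_ge0.
    apply: le_trans (nneseries_lim_ge k.+1 _) => //.
    by rewrite big_nat_recr//= leeDr// sume_ge0.
rewrite integral_nneseries//.
apply: (@le_lt_trans _ _ (\sum_(k <oo) (c k)%:E)%E).
  apply: lee_nneseries => [k _ _|k _]; first by apply: integral_ge0.
  rewrite integral_nneseries//.
  apply: lime_le; first by apply: is_cvg_nneseries => i _ _; exact: integral_ge0.
  apply: nearW => N; apply: (@le_trans _ _ (\sum_(0 <= i < N) (bad k i)%:R * ((b k i - a k i) / a k i))%:E); last by rewrite lee_fin.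
  rewrite -sumEFin; apply: lee_sum => i _.
  rewrite /F; under eq_integral do rewrite EFinM.
  rewrite ge0_integralZl//; last 2 first.
  - exact/measurable_EFinP.
  - by rewrite lee_fin divr_ge0// (ltW (a0 _ _)).
  rewrite integral_indic// (_ : (bad k i)%:R * ((b k i - a k i) / a k i) = (bad k i)%:R / a k i * (b k i - a k i)); last by ring.
  rewrite [leRHS]EFinM; apply: lee_wpmul2l.
    by rewrite lee_fin divr_ge0// (ltW (a0 _ _)).
  apply: (@le_trans _ _ (lebesgue_measure [set` `[a k i, b k i[ ])).
    apply: le_measure; [| |exact: subIsetl]; apply: mem_set; last exact: measurable_itv.
    by apply: measurableI => //; exact: measurable_itv.
  rewrite lebesgue_measure_itv/= lte_fin; case: ifP => // _.
  by rewrite lee_fin subr_ge0.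
have c0 k : 0 <= c k by apply: le_trans (sumc k 0%N); rewrite big_geq.
apply: (@le_lt_trans _ _ K%:E); last exact: ltry.
apply: lime_le; first by apply: is_cvg_nneseries => k _ _; rewrite lee_fin.
by apply: nearW => N; rewrite sumEFin lee_fin.
Qed.

End Cells.

(** * Weights, step sizes and the exceptional set *)

Section ExceptionalSet.
Context {R : realType}.

(** The tangent bound 1 - y/2 <= exp (-y/2) is squared and inverted. What remains is a polynomial
    inequality whose defect contains (1 - y)(5 - 2y), nonnegative for y <= 1. *)
Lemma expR_le_quadratic (y : R) : y <= 1 -> expR y <= 1 + y + 2 * y ^+ 2.
Proof.
move=> y1.
have e1 : 1 - y / 2 <= expR (- (y / 2)) := expR_ge1Dx _.
have y2 : 0 < 1 - y / 2 by lra.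
have -> : expR y = (expR (- (y / 2)) ^+ 2)^-1.
  by rewrite -expRM_natl -expRN; congr expR; field.
apply: (@le_trans _ _ ((1 - y / 2) ^+ 2)^-1).
  rewrite lef_pV2 ?posrE ?exprn_gt0 ?expR_gt0//.
  by rewrite lerXn2r ?nnegrE ?(ltW y2) ?expR_ge0.
rewrite -[leLHS]mul1r ler_pdivrMr ?exprn_gt0//.
have : 0 <= y ^+ 2 * ((1 - y) * (5 - 2 * y)).
  by rewrite mulr_ge0 ?sqr_ge0// mulr_ge0//; lra.
suff -> : (1 + y + 2 * y ^+ 2) * (1 - y / 2) ^+ 2 = 1 + y ^+ 2 * ((1 - y) * (5 - 2 * y)) / 4.
  by move=> ?; rewrite lerDl divr_ge0.
by field.
Qed.

(** The integral comparison for t^(-1-u) on [x, x+1], obtained from ln (x + 1) - ln x >= 1 / (x + 1)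
    and exp s >= 1 + s instead of an integral. *)
Lemma powR_telescope (u x : R) : 0 < u -> 0 < x ->
  u * (x + 1) `^ (- (1 + u)) <= x `^ (- u) - (x + 1) `^ (- u).
Proof.
move=> u0 x0; have x10 : 0 < x + 1 by lra.
rewrite /powR !gt_eqF//.
set l := ln (x + 1); set l' := ln x.
have ll : expR (- l) <= l - l'.
  have -> : expR (- l) = (x + 1)^-1 by rewrite expRN lnK ?posrE.
  have E : x / (x + 1) = 1 + - (x + 1)^-1 by field; rewrite gt_eqF.
  have := @le_ln1Dx R (- (x + 1)^-1).
  rewrite -E ln_div ?posrE// -/l -/l' ltrN2 invf_lt1// => H.
  by have := H ltac:(lra); lra.
have -> : - (1 + u) * l = - u * l + - l by ring.
have -> : - u * l' = - u * l + u * (l - l') by ring.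
rewrite !expRD.
have := expR_ge1Dx (u * (l - l')).
have := expR_gt0 (- u * l).
have : 0 <= u * (l - l' - expR (- l)) by rewrite mulr_ge0 ?(ltW u0)//; lra.
move: (expR (- u * l)) (expR (- l)) (expR (u * (l - l'))) => p q r H1 p0 H2.
suff : 0 <= p * (r - 1 - u * q) by lra.
by rewrite mulr_ge0 ?(ltW p0)//; lra.
Qed.

Definition weight (u : R) (k : nat) : R := k.+1%:R `^ (1 + u).

Lemma weight_ge1 (u : R) k : 0 < u -> 1 <= weight u k.
Proof.
move=> u0; rewrite /weight -[leLHS](powRr0 k.+1%:R).
by apply: ler_powR; [rewrite ler1n|lra].
Qed.

Lemma sum_inv_weight (u : R) (N : nat) : 0 < u ->
  \sum_(0 <= k < N) (weight u k)^-1 <= 1 + u^-1.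
Proof.
move=> u0; case: N => [|N]; first by rewrite big_geq// addr_ge0// invr_ge0 ltW.
rewrite big_nat_recl// /weight powR1 invr1 lerD2l.
rewrite -[leRHS]mul1r ler_pdivlMr// mulr_suml.
apply: (@le_trans _ _ (\sum_(0 <= k < N) (- (k.+2%:R `^ (- u)) - - (k.+1%:R `^ (- u))))).
  apply: ler_sum => k _; rewrite -powRN mulrC opprK [leRHS]addrC.
  by have := @powR_telescope u k.+1%:R u0 (ltr0Sn _ _); rewrite natr1.
pose f k : R := - (k.+1%:R `^ (- u)).
by rewrite (telescope_sumr f) // /f opprK powR1 gerDr oppr_le0 powR_ge0.
Qed.

Definition scale_root (k : nat) : R := expR (k%:R / 2).

Lemma scale_root_ge1 k : 1 <= scale_root k.
Proof. by rewrite /scale_root -[leLHS]expR0 ler_expR divr_ge0. Qed.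

Lemma scale_rootX2 k : scale_root k ^+ 2 = expR k%:R.
Proof. by rewrite /scale_root -expRM_natl; congr expR; field. Qed.

Definition step_size (u : R) (k : nat) : R := (scale_root k * weight u k)^-1.

Lemma step_size_gt0 u k : 0 < u -> 0 < step_size u k.
Proof.
move=> u0; rewrite invr_gt0 mulr_gt0//; first by rewrite (lt_le_trans ltr01)// scale_root_ge1.
by rewrite (lt_le_trans ltr01)// weight_ge1.
Qed.

Lemma step_size_le1 u k : 0 < u -> step_size u k <= 1.
Proof.
move=> u0; rewrite /step_size invf_le1.
  by rewrite mulr_ege1 ?scale_root_ge1 ?weight_ge1.
by have := step_size_gt0 k u0; rewrite /step_size invr_gt0.
Qed.

Variables (A : nat -> R) (n0 : nat) (u : R).
Hypotheses (A_ge0 : forall n, 0 <= A n) (A_decay : fast_decay A).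
Hypotheses (n0_gt0 : (0 < n0)%N) (An0_gt0 : 0 < A n0) (u_gt0 : 0 < u).

Local Notation g := (log_max_term A).
Local Notation h := (step_size u).

Lemma exceptional_set : exists E : set R,
  [/\ E `<=` [set r | 0 <= r], measurable E, finite_logarithmic_measure E &
    exists2 x1, 0 <= x1 & forall k x, x1 <= x -> g x < expR k.+1%:R -> ~ E (expR x) ->
      g (x + h k) - g x <= 1 + (g x - g (x - h k)) /\
      g (x + h k) - g x <= scale_root k + 1].
Proof.
have [x0 x00 gx0] := @log_max_term_large _ _ _ A_decay n0_gt0 An0_gt0 1.
pose y k i := x0 + i%:R * h k.
pose G k i := g (y k i).
pose bad k := bad_step (G k) (expR k.+1%:R) (scale_root k).
(* A bad step i discards the middle cell between its grid points i+1 and i+2. For x in that cell,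
   convexity bounds the increment from x to x + h above by the grid increment from i+2 to i+3, and
   the one from x - h to x below by that from i to i+1. *)
pose a k i := expR (y k i.+1); pose b k i := expR (y k i.+2).
(* A level has at most e^(k+1) / e^(k/2) + 2 (e^(k/2) + 1) <= (e + 4) e^(k/2) bad steps, each of
   logarithmic measure at most e^h - 1 <= 3 h. *)
pose M : R := 3 * (expR 1 + 4).
have h0 k : 0 < h k := step_size_gt0 k u_gt0.
have yS k i : y k i.+1 = y k i + h k by rewrite /y -natr1; ring.
have y_ge k i : x0 <= y k i by rewrite lerDl mulr_ge0// ltW.
have M0 : 0 <= M by rewrite mulr_ge0// addr_ge0 ?expR_ge0.
exists (bad_cells bad a b); split.
- move=> r [k _ [i _]]; rewrite /= in_itv/= => /andP[ar _].
  by apply: le_trans ar; exact: expR_ge0.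
- exact: measurable_bad_cells.
- apply: (@log_measure_bad_cells _ _ _ _ (fun k => M * (weight u k)^-1) (M * (1 + u^-1))).
  + by move=> k i; rewrite /a -[leLHS]expR0 ler_expR (le_trans x00).
  + by move=> k i; rewrite /a /b ler_expR (yS k i.+1) lerDl ltW.
  + move=> k N.
    have -> : \sum_(0 <= i < N) (bad k i)%:R * ((b k i - a k i) / a k i)
        = (\sum_(0 <= i < N) (bad k i)%:R) * (expR (h k) - 1).
      rewrite mulr_suml; apply: eq_bigr => i _; congr (_ * _).
      rewrite /b /a (yS k i.+1) expRD; field.
      by rewrite gt_eqF// expR_gt0.
    have s1 := scale_root_ge1 k.
    have s0 : 0 < scale_root k := lt_le_trans ltr01 s1.
    have cnt : \sum_(0 <= i < N) (bad k i)%:R <= (expR 1 + 4) * scale_root k.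
      apply: (@le_trans _ _ (expR k.+1%:R / scale_root k + 2 * (scale_root k + 1))).
        apply: (@count_bad_step _ (G k) (expR k.+1%:R) (scale_root k) N);
          [exact: s0| |exact: expR_ge0| |].
        * by rewrite /G /y mul0r addr0 (le_trans ler01).
        * move=> i j ij; apply: (log_max_term_mono A_ge0 A_decay An0_gt0).
          by rewrite lerD2l ler_wpM2r ?(ltW (h0 k))// ler_nat.
        * move=> i; rewrite /G !yS.
          apply: (log_max_term_increments A_ge0 A_decay An0_gt0); first exact: ltW.
          by rewrite lerDl ltW.
      have -> : expR k.+1%:R / scale_root k = expR 1 * scale_root k.
        by rewrite -natr1 expRD -scale_rootX2; field; rewrite gt_eqF.
      have := expR_gt0 (1 : R); nra.
    have hk1 := step_size_le1 k u_gt0.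
    have eh : expR (h k) - 1 <= 3 * h k.
      have := expR_le_quadratic hk1; have := h0 k; move: (h k) (expR _) hk1 => t e *; nra.
    have -> : M / weight u k = (expR 1 + 4) * scale_root k * (3 * h k).
      rewrite /M /step_size; field.
      by rewrite !gt_eqF// (lt_le_trans ltr01)// weight_ge1.
    apply: ler_pM => //; first by apply: sumr_ge0 => i _; rewrite ler0n.
    by have := expR_ge1Dx (h k); have := h0 k; lra.
  + by move=> N; rewrite -mulr_sumr ler_wpM2l// sum_inv_weight.
(* As h <= 1, starting at x0 + 1 puts x at or beyond the grid point of index 1, so that a preceding
   grid point exists. *)
exists (x0 + 1) => [|k x x1 gx xE]; first by rewrite addr_ge0.
have hk1 := step_size_le1 k u_gt0; have hk0 := h0 k.
have q1 : 1 <= (x - x0) / h k by rewrite ler_pdivlMr// mul1r; lra.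
have := truncn_itv (le_trans ler01 q1).
have : (0 < Num.truncn ((x - x0) / h k))%N by rewrite truncn_gt0.
case: (Num.truncn _) => // i _ /andP[]; rewrite ler_pdivlMr// ltr_pdivrMr// => yi yi2.
have yx : y k i.+1 <= x by rewrite /y; lra.
have xy : x < y k i.+2 by rewrite /y; lra.
have nbad : ~~ bad k i.
  apply/negP => bi; apply: xE; exists k => //; exists i => //=.
  by rewrite in_itv/= /a /b ler_expR ltr_expR yx.
have gyx : g (y k i.+1) <= g x by apply: (log_max_term_mono A_ge0 A_decay An0_gt0).
have fwd : g (x + h k) - g x <= g (y k i.+3) - g (y k i.+2).
  rewrite (yS k i.+2).
  by apply: (log_max_term_increments A_ge0 A_decay An0_gt0); [exact: ltW|exact: ltW].
have bwd : g (y k i.+1) - g (y k i) <= g x - g (x - h k).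
  have yxh : y k i <= x - h k by rewrite lerBrDr -yS.
  have := log_max_term_increments A_ge0 A_decay An0_gt0 (ltW hk0) yxh.
  by rewrite subrK -yS.
move: nbad; rewrite /bad /bad_step /G (le_lt_trans gyx gx) /= negb_or -!leNgt => /andP[].
move: fwd bwd; move: (g (x + h k)) (g x) (g (x - h k)) (g (y k i.+3)) (g (y k i.+2)) (g (y k i.+1)) (g (y k i)).
by clear => *; split; lra.
Qed.

End ExceptionalSet.

(** * Decay of the terms away from the central index *)

Section OffExceptionalSet.
Context {R : realType}.

(* With X = exp (n h - p), the bound min X X^-1 <= 4 X / (1 + X)^2 makes the
   n-th term comparable to an increment of the logistic function X / (1 + X). *)
Lemma two_sided_geometric_sum (t : nat -> R) (p h : R) (N : nat) : 0 < h -> h <= 1 ->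
  (forall n, t n <= expR (p - n%:R * h)) ->
  (forall n, t n <= expR (1 - p + n%:R * h)) ->
  \sum_(0 <= n < N) t n <= 4 * expR 2 / h.
Proof.
move=> h0 h1 tR tL.
pose X n := expR (n%:R * h - p); pose sigma n := X n / (1 + X n).
have X0 n : 0 < X n := expR_gt0 _.
have step n : t n <= 4 * expR 2 / h * (sigma n.+1 - sigma n).
  have tX : t n <= expR 1 * X n.
    by apply: (le_trans (tL n)); rewrite /X -expRD ler_expR; lra.
  have tXV : t n * X n <= expR 1.
    rewrite -ler_pdivlMr// /X -expRN -expRD; apply: (le_trans (tR n)).
    by rewrite ler_expR; lra.
  have XS : X n.+1 = X n * expR h by rewrite /X -natr1 -expRD; congr expR; ring.
  have H1 : 1 + h <= expR h := expR_ge1Dx h.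
  have He : expR h <= expR 1 by rewrite ler_expR.
  (* One factor e is the slack 1 in the left-hand bound on t; the other is H = e^h <= e, paid when
     (1 + x)(1 + x H) is compared with (1 + x)^2. *)
  have -> : expR 2 = expR 1 * expR 1 :> R by rewrite -expRD; congr expR; ring.
  have e0 : 0 < expR 1 :> R := expR_gt0 1.
  have D1 : 0 < 1 + X n by have := X0 n; lra.
  have D2 : 0 < 1 + X n * expR h by have := mulr_gt0 (X0 n) (expR_gt0 h); lra.
  rewrite /sigma XS.
  move: (X n) (expR h) (expR 1) (X0 n) tX tXV H1 He e0 D1 D2 => x H e x0 tX tXV H1 He e0 D1 D2.
  have -> : x * H / (1 + x * H) - x / (1 + x) = x * (H - 1) / ((1 + x) * (1 + x * H)).
    by field; rewrite !gt_eqF.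
  rewrite mulrA ler_pdivlMr ?mulr_gt0//.
  have -> : 4 * (e * e) / h * (x * (H - 1)) = 4 * (e * e) * x * ((H - 1) / h) by field; rewrite gt_eqF.
  have Hh : 1 <= (H - 1) / h by rewrite ler_pdivlMr// mul1r; lra.
  apply: (@le_trans _ _ (4 * (e * e) * x)); last first.
    by rewrite ler_peMr// !mulr_ge0 ?(ltW e0) ?(ltW x0).
  have tx2 : t n * (1 + x) ^+ 2 <= 4 * (e * x).
    have [x1|x1] := leP x 1.
      have [t0|t0] := leP (t n) 0.
        apply: (@le_trans _ _ 0); first by apply: mulr_le0_ge0 => //; exact: sqr_ge0.
        by rewrite !mulr_ge0 ?(ltW e0) ?(ltW x0).
      rewrite mulrC; apply: ler_pM => //; [exact: sqr_ge0|exact: ltW|]; nra.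
    have -> : t n * (1 + x) ^+ 2 = t n * x * ((1 + x) ^+ 2 / x) by field; rewrite gt_eqF.
    have -> : 4 * (e * x) = e * (4 * x) by ring.
    have [t0|t0] := leP (t n) 0.
      apply: (@le_trans _ _ 0); last by rewrite !mulr_ge0 ?(ltW e0) ?(ltW x0).
      apply: mulr_le0_ge0; first by apply: mulr_le0_ge0 => //; exact: ltW.
      by rewrite divr_ge0 ?sqr_ge0 ?(ltW x0).
    apply: ler_pM => //; [by rewrite mulr_ge0 ?(ltW t0) ?(ltW x0)|by rewrite divr_ge0 ?sqr_ge0 ?(ltW x0)|].
    by rewrite ler_pdivrMr//; nra.
  have eH1 : 1 <= H by lra.
  have xH : 1 + x * H <= (1 + x) * H by nra.
  have [t0|t0] := leP (t n) 0.
    apply: (@le_trans _ _ 0); last by rewrite !mulr_ge0 ?(ltW e0) ?(ltW x0).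
    by apply: mulr_le0_ge0 => //; rewrite mulr_ge0 ?ltW.
  apply: (@le_trans _ _ (t n * (1 + x) ^+ 2 * H)).
    rewrite -[leRHS]mulrA; apply: ler_wpM2l; first exact: ltW.
    by rewrite expr2 -mulrA; apply: ler_wpM2l => //; exact: ltW.
  have -> : 4 * (e * e) * x = 4 * (e * x) * e by ring.
  by apply: ler_pM => //; [rewrite mulr_ge0 ?sqr_ge0 ?(ltW t0)|lra].
apply: (@le_trans _ _ (\sum_(0 <= n < N) 4 * expR 2 / h * (sigma n.+1 - sigma n))).
  exact: ler_sum.
rewrite -mulr_sumr telescope_sumr// -[leRHS]mulr1 ler_wpM2l//.
  by rewrite divr_ge0 ?(ltW h0)// mulr_ge0// expR_ge0.
have s1 : sigma N <= 1.
  by rewrite /sigma ler_pdivrMr ?mul1r; have := X0 N; lra.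
have s0 : 0 <= sigma 0%N by rewrite divr_ge0 ?(ltW (X0 _))//; have := X0 0%N; lra.
by lra.
Qed.

(** Half of the decay pays for the weight: n + 1 <= 4V exp ((n + 1) / (4V)), squared. The other half
    is geometric with ratio q and 1 - q >= 1 / (4V), which accounts for 64 = 16 x 4 and for the
    third power of V. *)
Lemma geometric_moment_sum (t : nat -> R) (V : R) (N : nat) : 1 <= V ->
  (forall n, t n <= expR (1 - n%:R / V)) ->
  \sum_(0 <= n < N) n.+1%:R ^+ 2 * t n <= 64 * expR 2 * V ^+ 3.
Proof.
move=> V1 tV; have V0 : 0 < V by lra.
pose q := expR (- (2 * V)^-1).
have step n : n.+1%:R ^+ 2 * t n <= 16 * V ^+ 2 * expR 2 * q ^+ n.
  apply: (@le_trans _ _ ((4 * V * expR (n.+1%:R / (4 * V))) ^+ 2 * expR (1 - n%:R / V))).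
    apply: (@le_trans _ _ (n.+1%:R ^+ 2 * expR (1 - n%:R / V))).
      by rewrite ler_wpM2l ?sqr_ge0.
    rewrite ler_wpM2r ?expR_ge0// lerXn2r ?nnegrE ?ler0n ?mulr_ge0 ?expR_ge0 ?(ltW V0)//.
    have := expR_ge1Dx (n.+1%:R / (4 * V)) => H.
    rewrite -ler_pdivrMl ?mulr_gt0// mulrC; lra.
  rewrite exprMn -expRM_natl /q -expRM_natl.
  have -> : (4 * V) ^+ 2 = 16 * V ^+ 2 by ring.
  rewrite -[leLHS]mulrA -[leRHS]mulrA; apply: ler_wpM2l; first by rewrite mulr_ge0 ?sqr_ge0.
  rewrite -[leLHS]expRD -[leRHS]expRD ler_expR.
  have -> : 2 * (n.+1%:R / (4 * V)) + (1 - n%:R / V) = 1 + (2 * V)^-1 + n%:R * - (2 * V)^-1.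
    by rewrite -natr1; field; rewrite gt_eqF.
  rewrite lerD2r; have : (2 * V)^-1 <= 1 by rewrite invf_le1; lra.
  lra.
have q1 : 1 - q >= (4 * V)^-1.
  have y1 : (2 * V)^-1 <= 2^-1 by rewrite lef_pV2 ?posrE; lra.
  have y0 : 0 < (2 * V)^-1 by rewrite invr_gt0; lra.
  have := @expR_le_quadratic R (- (2 * V)^-1).
  have -> : (4 * V)^-1 = (2 * V)^-1 / 2 by field; rewrite gt_eqF.
  rewrite /q.
  have := expR_ge1Dx ((2 * V)^-1); rewrite -[in leRHS](opprK (2 * V)^-1) [in leRHS]expRN.
  have := expR_gt0 (- (2 * V)^-1).
  move: (expR (- (2 * V)^-1)) ((2 * V)^-1) y0 y1 => e y y0 y1 e0.
  rewrite -[_^-1]mul1r ler_pdivlMr// => H _.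
  clear -H y0 y1 e0; nra.
have geo : \sum_(0 <= n < N) q ^+ n <= 4 * V.
  have q0 : 0 < 1 - q by apply: lt_le_trans q1; rewrite invr_gt0; lra.
  have E : \sum_(0 <= n < N) q ^+ n * (1 - q) = 1 - q ^+ N.
    elim: N => [|N IH]; first by rewrite big_geq// expr0 subrr.
    by rewrite big_nat_recr//= IH exprS; ring.
  have : (\sum_(0 <= n < N) q ^+ n) * (1 - q) <= 1.
    by rewrite mulr_suml E gerDl oppr_le0 exprn_ge0// expR_ge0.
  have S0 : 0 <= \sum_(0 <= n < N) q ^+ n by apply: sumr_ge0 => n _; rewrite exprn_ge0// expR_ge0.
  move: (\sum_(_ <= _ < _) _) S0 => S S0 SH.
  have : S * (4 * V)^-1 <= 1 by apply: le_trans SH; rewrite ler_wpM2l.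
  by rewrite ler_pdivrMr ?mul1r//; lra.
apply: (@le_trans _ _ (\sum_(0 <= n < N) 16 * V ^+ 2 * expR 2 * q ^+ n)).
  exact: ler_sum.
rewrite -mulr_sumr (_ : 64 * _ * _ = 16 * V ^+ 2 * expR 2 * (4 * V)); last by ring.
by rewrite ler_wpM2l// !mulr_ge0 ?expR_ge0 ?(ltW V0).
Qed.

Variables (A : nat -> R) (n0 : nat).
Hypotheses (A_ge0 : forall n, 0 <= A n) (A_decay : fast_decay A).
Hypothesis An0_gt0 : 0 < A n0.

Local Notation mu := (max_term A).
Local Notation g := (log_max_term A).

(** The n-th term at x + s is at most mu there. A positive s controls the large indices, a negative
    s the small ones. *)
Lemma term_ratio x s n :
  A n * expR x ^+ n / mu x <= expR (g (x + s) - g x - n%:R * s).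
Proof.
have mx := max_term_gt0 A_decay An0_gt0 x.
rewrite ler_pdivrMr// (max_termE A_decay An0_gt0 x) -expRD.
have -> : g (x + s) - g x - n%:R * s + g x = g (x + s) + - (n%:R * s) by ring.
rewrite expRD -(max_termE A_decay An0_gt0) expRN ler_pdivlMr ?expR_gt0//.
rewrite -mulrA -expRM_natl -expRD -mulrDr expRM_natl.
exact: max_term_ge.
Qed.

(** Divided by mu, the terms are at most 1 and dominate their squares. With p = g (x + h) - g x, the
    hypothesis on the second difference supplies the decay on the left, up to the slack 1. *)
Lemma variance_bound (x h : R) N : 0 < h -> h <= 1 ->
  g (x + h) - g x <= 1 + (g x - g (x - h)) ->
  \sum_(0 <= n < N) (A n * expR x ^+ n) ^+ 2 <= 4 * expR 2 / h * mu x ^+ 2.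
Proof.
move=> h0 h1 gx; have mx := max_term_gt0 A_decay An0_gt0 x.
rewrite -ler_pdivrMr ?exprn_gt0// mulr_suml.
apply: (@le_trans _ _ (\sum_(0 <= n < N) (A n * expR x ^+ n / mu x))).
  apply: ler_sum => n _; rewrite -expr_div_n expr2 ler_piMr//.
    by rewrite divr_ge0 ?(ltW mx)// mulr_ge0// exprn_ge0// expR_ge0.
  by rewrite ler_pdivrMr// mul1r max_term_ge.
apply: (@two_sided_geometric_sum _ (g (x + h) - g x)) => // n; first exact: term_ratio.
apply: le_trans (term_ratio x (- h) n) _; rewrite ler_expR mulrN opprK lerD2r.
by move: gx; move: (g (x + h)) (g x) (g (x - h)) => *; lra.
Qed.

Lemma moment_bound (x h D : R) N : 0 < h -> h <= 1 -> 1 <= D ->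
  g (x + h) - g x <= D ->
  \sum_(0 <= n < N) n.+1%:R ^+ 2 * (A n * expR x ^+ n)
    <= 64 * expR 2 * (D / h) ^+ 3 * mu x.
Proof.
move=> h0 h1 D1 gx; have mx := max_term_gt0 A_decay An0_gt0 x.
have D0 : 0 < D := lt_le_trans ltr01 D1.
rewrite -ler_pdivrMr// mulr_suml.
have -> : \sum_(0 <= n < N) n.+1%:R ^+ 2 * (A n * expR x ^+ n) / mu x
    = \sum_(0 <= n < N) n.+1%:R ^+ 2 * (A n * expR x ^+ n / mu x).
  by apply: eq_bigr => n _; rewrite -mulrA.
apply: (@geometric_moment_sum (fun n => A n * expR x ^+ n / mu x)) => [|n]; first by rewrite ler_pdivlMr// mul1r; lra.
have := term_ratio x h n.
have : A n * expR x ^+ n / mu x <= 1 by rewrite ler_pdivrMr// mul1r max_term_ge.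
move: (_ / mu x) (g (x + h) - g x) gx => t p pD t1 tp.
have -> : 1 - n%:R / (D / h) = (D - n%:R * h) / D.
  by field; rewrite !gt_eqF.
(* Beyond n h = D the exponent D - n h is nonpositive, so division by D >= 1 only weakens the bound;
   before that point the trivial bound 1 is enough. *)
have [neg|pos] := leP (D - n%:R * h) 0.
  apply: (le_trans tp); rewrite ler_expR ler_pdivlMr//; nra.
apply: (le_trans t1); rewrite -[leLHS]expR0 ler_expR divr_ge0// ltW//.
Qed.

End OffExceptionalSet.

(** * Integrating out one independent factor *)

Section ProductExpectation.
Import HBNNSimple.
Context {d : measure_display} {T : measurableType d} {R : realType}.
Variable P : probability T R.

(** The last hypothesis is independence of Z from the weight G on D, in the form that the later
    induction over the factors supplies; for a simple f it is summed over the level sets of f. *)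
Lemma integral_mul_simple (D : set T) (G : T -> R) (c : R) (Z : T -> R)
    (f : {nnsfun (measurableTypeR R) >-> R}) :
  measurable D -> measurable_fun [set: T] G -> (forall x, 0 <= G x) ->
  measurable_fun [set: T] Z -> 0 <= c ->
  (forall B, measurable B ->
    \int[P]_(x in D `&` Z @^-1` B) (G x)%:E = c%:E * P (Z @^-1` B))%E ->
  (\int[P]_(x in D) (G x * f (Z x))%:E = c%:E * \int[P]_x (f (Z x))%:E)%E.
Proof.
move=> mD mG G0 mZ c0 H.
pose s := fset_set (range f).
pose B (i : 'I_#|`s|) := f @^-1` [set s`_i].
have mB i : measurable (B i) by exact: measurable_funPTI.
have mZB i : measurable (Z @^-1` B i) by rewrite -[X in measurable X]setTI; exact: (mZ measurableT _ (mB i)).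
have s0 (i : 'I_#|`s|) : 0 <= s`_i.
  have : s`_i \in s by exact: mem_nth.
  by rewrite in_fset_set// inE => -[x _ <-].
have fE x : f (Z x) = \sum_(i < #|`s|) s`_i * \1_(Z @^-1` B i) x.
  by rewrite [LHS]fimfunEord; apply: eq_bigr.
have mG' : measurable_fun D (EFin \o G).
  by apply/measurable_EFinP; exact: measurable_funTS.
(* Used twice: with the weight G on D, and with the weight 1 on the whole space for the right-hand
   side. *)
have key D' (F : T -> R) (m : set T -> \bar R) : measurable D' ->
    measurable_fun D' F -> (forall x, 0 <= F x) ->
    (forall i, \int[P]_(x in D') (F x * \1_(Z @^-1` B i) x)%:E = m (Z @^-1` B i))%E ->
    (\int[P]_(x in D') (F x * f (Z x))%:E = \sum_(i < #|`s|) (s`_i)%:E * m (Z @^-1` B i))%E.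
  move=> mD' mF F0 FE.
  under eq_integral => x _.
    rewrite fE mulr_sumr -sumEFin.
    under eq_bigr do rewrite mulrCA EFinM.
    over.
  have mFi i : measurable_fun D' (fun x => (F x * \1_(Z @^-1` B i) x)%:E).
    by apply/measurable_EFinP; apply: measurable_funM => //; exact: measurable_indic.
  rewrite ge0_integral_sum//; last 2 first.
  - by move=> i; exact: measurable_funeM.
  - by move=> i x _; rewrite mule_ge0// lee_fin ?s0// mulr_ge0// indicE ler0n.
  apply: eq_bigr => i _; rewrite ge0_integralZl//.
  - by rewrite FE.
  - by move=> x _; rewrite lee_fin mulr_ge0// indicE ler0n.
  - by rewrite lee_fin.
rewrite (key D G (fun A => \int[P]_(x in D `&` A) (G x)%:E)%E)//; last 2 first.
- by move=> *; exact: measurable_funTS.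
- move=> i; rewrite integral_mkcondr; apply: eq_integral => x _.
  by rewrite patchE indicE; case: (_ \in _); rewrite ?mulr1 ?mulr0.
have := key [set: T] (cst 1) P measurableT (measurable_cst _) (fun=> ler01).
under [X in (_ -> X = _) -> _]eq_integral do rewrite mul1r.
move=> ->; last first.
  by move=> i; under eq_integral do rewrite mul1r; rewrite integral_indic// setIT.
rewrite ge0_sume_distrr; last by move=> i _; rewrite mule_ge0// lee_fin.
by apply: eq_bigr => i _; rewrite (H _ (mB i)) muleCA.
Qed.

Lemma integral_mul_comp (D : set T) (G : T -> R) (c : R) (Z : T -> R) (f : R -> R) :
  measurable D -> measurable_fun [set: T] G -> (forall x, 0 <= G x) ->
  measurable_fun [set: T] Z -> measurable_fun [set: R] f -> (forall x, 0 <= f x) -> 0 <= c ->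
  (forall B, measurable B ->
    \int[P]_(x in D `&` Z @^-1` B) (G x)%:E = c%:E * P (Z @^-1` B))%E ->
  (\int[P]_(x in D) (G x * f (Z x))%:E = c%:E * \int[P]_x (f (Z x))%:E)%E.
Proof.
move=> mD mG G0 mZ mf f0 c0 H.
have mf' : measurable_fun [set: measurableTypeR R] (EFin \o f) by apply/measurable_EFinP.
pose f_ := nnsfun_approx measurableT mf'.
have f_nd n m x : (n <= m)%N -> f_ n x <= f_ m x.
  by move=> nm; exact/lefP/nd_nnsfun_approx.
have f_cvg x : (f_ n x)%:E @[n --> \oo] --> (f x)%:E.
  by apply: (@cvg_nnsfun_approx _ _ _ _ measurableT _ mf') => // ? _; rewrite lee_fin.
have mfZ n : measurable_fun [set: T] (f_ n \o Z) by exact: measurableT_comp.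
have lhs : (\int[P]_(x in D) (G x * f_ n (Z x))%:E @[n --> \oo]
     --> \int[P]_(x in D) (G x * f (Z x))%:E)%E.
  have -> : (\int[P]_(x in D) (G x * f (Z x))%:E
     = \int[P]_(x in D) limn (fun n => (G x * f_ n (Z x))%:E))%E.
    apply: eq_integral => x _; apply/esym/cvg_lim => //.
    rewrite EFinM; under eq_fun do rewrite EFinM.
    by apply: cvgeZl => //; exact: f_cvg.
  apply: cvg_monotone_convergence => //.
  - move=> n; apply/measurable_EFinP; apply: measurable_funTS.
    exact: (measurable_funM mG (mfZ n)).
  - by move=> n x _; rewrite lee_fin mulr_ge0.
  - by move=> x _ n m nm; rewrite lee_fin ler_wpM2l// f_nd.
have rhs : (c%:E * \int[P]_x (f_ n (Z x))%:E @[n --> \oo]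
     --> c%:E * \int[P]_x (f (Z x))%:E)%E.
  apply: cvgeZl => //.
  have -> : (\int[P]_x (f (Z x))%:E = \int[P]_x limn (fun n => (f_ n (Z x))%:E))%E.
    by apply: eq_integral => x _; apply/esym/cvg_lim => //; exact: f_cvg.
  apply: cvg_monotone_convergence => //.
  - move=> n; apply/measurable_EFinP; exact: mfZ.
  - by move=> n x _; rewrite lee_fin.
  - by move=> x _ n m nm; rewrite lee_fin f_nd.
have E : (fun n => \int[P]_(x in D) (G x * f_ n (Z x))%:E)%E
    = (fun n => c%:E * \int[P]_x (f_ n (Z x))%:E)%E.
  by apply/funext => n; exact: integral_mul_simple.
by move: lhs; rewrite E => lhs; exact: cvg_unique lhs rhs.
Qed.

End ProductExpectation.

(** * Expectation of a product of independent exponentials *)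

Section ProductIndependent.
Context {d : measure_display} {T : measurableType d} {R : realType}.
Variable P : probability T R.
Variables (Z : nat -> T -> R) (N : nat) (e : nat -> R).
Hypothesis mZ : forall n, measurable_fun [set: T] (Z n).
Hypothesis indep : forall B : nat -> set R, (forall n, measurable (B n)) ->
  P (\bigcap_(n in [set n | (n < N)%N]) (Z n @^-1` B n))
  = (\prod_(0 <= n < N) fine (P (Z n @^-1` B n)))%:E.
Hypothesis e_def : forall n, (\int[P]_x (expR (Z n x))%:E = (e n)%:E)%E.

Let mZB n B : measurable B -> measurable (Z n @^-1` B).
Proof. by move=> mB; rewrite -[X in measurable X]setTI; exact: mZ. Qed.

Lemma integral_prod_expR :
  (\int[P]_x (\prod_(0 <= n < N) expR (Z n x))%:E = (\prod_(0 <= n < N) e n)%:E)%E.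
Proof.
pose S m (B : nat -> set R) := \bigcap_(n in [set n | (m <= n < N)%N]) (Z n @^-1` B n).
have e0 n : 0 <= e n.
  by rewrite -lee_fin -e_def integral_ge0// => x _; rewrite lee_fin expR_ge0.
(* The induction keeps arbitrary events for the variables not yet integrated; each step turns the
   event of index m into an exponential factor. *)
suff Q m : (m <= N)%N -> forall B : nat -> set R, (forall n, measurable (B n)) ->
    (\int[P]_(x in S m B) (\prod_(0 <= n < m) expR (Z n x))%:E
     = (\prod_(0 <= n < m) e n * \prod_(m <= n < N) fine (P (Z n @^-1` B n)))%:E)%E.
  have := Q N (leqnn N) (fun=> setT) (fun=> measurableT).
  rewrite [X in _ = X%:E -> _](_ : _ = \prod_(0 <= n < N) e n); last first.
    by rewrite [X in _ * X]big_geq// mulr1.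
  suff -> : S N (fun=> setT) = setT by [].
  by rewrite /S; apply/seteqP; split => // x _ n /= /andP[/leq_trans H /H]; rewrite ltnn.
elim: m => [_ B mB|m IH mN B mB].
  rewrite [X in _ = X%:E](_ : _ = \prod_(0 <= n < N) fine (P (Z n @^-1` B n))); last first.
    by rewrite big_geq// mul1r.
  under eq_integral do rewrite big_geq//.
  rewrite integral_cst ?mul1e//; last by apply: bigcap_measurableType => n _; exact: mZB.
  exact: indep.
have mS : measurable (S m.+1 B) by apply: bigcap_measurableType => n _; exact: mZB.
under eq_integral do rewrite big_nat_recr//=.
have p0 : 0 <= \prod_(m.+1 <= n < N) fine (P (Z n @^-1` B n)).
  by apply: prodr_ge0 => n _; rewrite fine_ge0.
rewrite (@integral_mul_comp _ _ _ P _ _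
  (\prod_(0 <= n < m) e n * \prod_(m.+1 <= n < N) fine (P (Z n @^-1` B n))) (Z m) expR)//.
- by rewrite e_def -EFinM big_nat_recr//= mulrAC.
- by apply: measurable_prod => n _; exact: measurableT_comp.
- by move=> x; apply: prodr_ge0 => n _; exact: expR_ge0.
- by rewrite mulr_ge0// prodr_ge0.
- move=> B' mB'.
  (* The test event for Z m fills the free slot m, which brings the induction hypothesis into the
     form required by [integral_mul_comp]. *)
  pose B'' n := if n == m then B' else B n.
  have mB'' n : measurable (B'' n) by rewrite /B''; case: ifP.
  have -> : S m.+1 B `&` Z m @^-1` B' = S m B''.
    apply/seteqP; split => x.
      move=> [xS xB'] n /= /andP[mn nN]; rewrite /B''; case: eqVneq => [->//|nm].
      by apply: xS => /=; rewrite nN andbT ltn_neqAle eq_sym nm.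
    move=> xS; split; last by have := xS m; rewrite /= leqnn mN /B'' eqxx; exact.
    move=> n /= /andP[mn nN]; have := xS n; rewrite /= (ltnW mn) nN /B'' gtn_eqF//.
    exact.
  rewrite (IH (ltnW mN) _ mB'') [\prod_(m <= n < N) _]big_ltn// {1}/B'' eqxx.
  rewrite -[in RHS](@fineK _ (P (Z m @^-1` B'))) ?fin_num_measure//; last exact: mZB.
  rewrite -EFinM mulrCA mulrC; congr (_ * _)%:E; congr (_ * _).
  by apply: eq_big_nat => n /andP[mn _]; rewrite /B'' gtn_eqF.
Qed.

End ProductIndependent.

(** * Real functionals of complex random variables *)

Section ComplexMeasurability.
Context {d : measure_display} {T : measurableType d} {R : realType}.
Local Notation C := (complex_field R).

(** One-sided, but exchanging z and w gives the two-sided bound. Superlevel sets of such f are open,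
    which links real Borel sets to [borel_complex]. *)
Definition lipschitz_modulus (f : C -> R) (K : R) :=
  forall z w, f z - f w <= K * modulus (z - w).

Lemma borel_preimage_lipschitz (f : C -> R) K (B : set R) :
  lipschitz_modulus f K -> measurable B -> borel_complex (f @^-1` B).
Proof.
move=> fK mB.
pose C' := g_sigma_algebraType [set U : set C | open U].
suff mf : measurable_fun [set: C'] (f : C' -> R).
  by rewrite -[f @^-1` B]setTI; exact: (mf measurableT _ mB).
apply: (measurability _ (RGenOInfty.measurableE R)) => //.
move=> _ [_ [x ->] <-]; rewrite setTI; apply: sub_sigma_algebra.
rewrite /= openE => z /=; rewrite in_itv/= andbT => xz.
pose K' := `|K| + 1; have K'0 : 0 < K' by rewrite ltr_wpDl.
apply/nbhs_ballP; exists (to_complex ((f z - x) / K')) => /=.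
  by rewrite -[0]/(to_complex 0) ltr_to_complex divr_gt0// subr_gt0.
move=> w; rewrite /ball/= norm_modulus ltr_to_complex ltr_pdivlMr// => zw.
rewrite in_itv/= andbT.
have := fK z w; have := modulus_ge0 (z - w); move: zw.
have : K <= K' by rewrite /K'; have := ler_norm K; lra.
move: (modulus (z - w)) => t; clear; nra.
Qed.

Lemma complex_rv_measurable (X : T -> C) (f : C -> R) K :
  complex_random_variable X -> lipschitz_modulus f K ->
  measurable_fun [set: T] (f \o X).
Proof.
move=> mX fK _ B mB; rewrite setTI comp_preimage.
by apply: mX; exact: borel_preimage_lipschitz fK mB.
Qed.

Lemma lipschitz_normc : lipschitz_modulus (fun z => modulus z) 1.
Proof.
move=> z w; rewrite mul1r lerBlDr -{1}[z](subrK w); exact: modulus_triangle.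
Qed.

Lemma lipschitz_Re_mul (c : C) : lipschitz_modulus (fun z => complex.Re (c * z)) (modulus c).
Proof.
move=> z w; rewrite -modulusM mulrBr; apply: le_trans (normr_Re_le _).
case: (c * z) => x y; case: (c * w) => x' y' /=; exact: ler_norm.
Qed.

Lemma lipschitz_Im : lipschitz_modulus (fun z => complex.Im z) 1.
Proof.
move=> z w; rewrite mul1r; apply: le_trans (normr_Im_le _).
case: z => x y; case: w => x' y' /=; exact: ler_norm.
Qed.

End ComplexMeasurability.

(** * From subgaussian tails to exponential moments *)

Section SubgaussianMoments.
Context {d : measure_display} {T : measurableType d} {R : realType}.
Variable P : probability T R.

Lemma measurable_superlevel (V : T -> R) (x : R) :
  measurable_fun [set: T] V -> measurable [set w | x < V w].
Proof.
move=> mV; rewrite (_ : [set w | _] = V @^-1` [set` `]x, +oo[ ]).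
  by rewrite -[X in measurable X]setTI; exact: mV.
by apply/seteqP; split => w /=; rewrite in_itv/= andbT.
Qed.

(** Halving the exponent leaves room: when V^2 / tau^2 is sliced at the integers, slice j costs K
    e^(-j) e^((j+2)/2) = K e e^(-j/2), and e^(-1/2) <= 2/3 sums this to 3 K e. *)
Lemma exp_square_moment (V : T -> R) (K tau : R) :
  measurable_fun [set: T] V -> (forall x, 0 <= V x) -> 0 < tau -> 0 <= K ->
  (forall t : R, 0 <= t -> (P [set w | (t < V w)%R] <= (K * expR (- (t ^+ 2 / tau ^+ 2)))%:E)%E) ->
  (\int[P]_x (expR (V x ^+ 2 / (2 * tau ^+ 2)))%:E <= ((1 + 3 * K) * expR 1)%:E)%E.
Proof.
move=> mV V0 tau0 K0 tail.
(* Values of V^2 / tau^2 with integer part j + 1 are charged to A j, because the tail hypothesis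
   concerns strict inequalities. *)
pose A (j : nat) := [set w | tau * Num.sqrt j%:R < V w].
have mA j : measurable (A j) by exact: measurable_superlevel.
pose f (j : nat) x : \bar R := (expR (j.+2%:R / 2) * \1_(A j) x)%:E.
have f0 j x : (0 <= f j x)%E by rewrite lee_fin mulr_ge0 ?expR_ge0// indicE ler0n.
have mf j : measurable_fun [set: T] (f j).
  by apply/measurable_EFinP; apply: measurable_funM => //; exact: measurable_indic.
have PA j : (P (A j) <= (K * expR (- j%:R))%:E)%E.
  apply: le_trans (tail _ _) _; first by rewrite mulr_ge0// ?(ltW tau0)// sqrtr_ge0.
  by rewrite exprMn sqr_sqrtr// mulrAC mulfV ?mul1r// expf_neq0// gt_eqF.
have pointwise x : ((expR (V x ^+ 2 / (2 * tau ^+ 2)))%:E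
    <= (expR 1)%:E + \sum_(j <oo) f j x)%E.
  set U := V x ^+ 2 / tau ^+ 2.
  have -> : V x ^+ 2 / (2 * tau ^+ 2) = U / 2 by rewrite /U; field; rewrite gt_eqF.
  have U0 : 0 <= U by rewrite divr_ge0// sqr_ge0.
  have /andP[mU Um] := truncn_itv U0.
  case: (Num.truncn U) mU Um => [|j] mU Um.
    apply: (@le_trans _ _ (expR 1)%:E); last by rewrite leeDl// nneseries_ge0.
    by rewrite lee_fin ler_expR; lra.
  apply: (@le_trans _ _ (f j x)); last first.
    apply: (@le_trans _ _ (\sum_(j <oo) f j x)%E); last by rewrite leeDr// lee_fin expR_ge0.
    apply: le_trans (nneseries_lim_ge j.+1 _) => //.
    by rewrite big_nat_recr//= leeDr// sume_ge0.
  rewrite /f indicE mem_set.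
    by rewrite mulr1 lee_fin ler_expR ler_pM2r// ltW.
  rewrite /A/= -(@ltr_pXn2r _ 2)// ?nnegrE ?mulr_ge0 ?sqrtr_ge0 ?(ltW tau0)//.
  rewrite exprMn sqr_sqrtr// mulrC -ltr_pdivlMr ?exprn_gt0// -/U.
  by apply: lt_le_trans mU; rewrite ltr_nat.
apply: (@le_trans _ _ (\int[P]_x ((expR 1)%:E + \sum_(j <oo) f j x))%E).
  apply: ge0_le_integral => //.
  - apply/measurable_EFinP; apply: measurableT_comp => //.
    by apply: measurable_funM => //; exact: measurable_funX.
  - by apply: emeasurable_funD => //; apply: ge0_emeasurable_sum => // *; exact: f0.
rewrite ge0_integralD//; last 2 first.
- by move=> x _; rewrite nneseries_ge0.
- by apply: ge0_emeasurable_sum => // *; exact: f0.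
rewrite integral_cst//= probability_setT mule1 mulrDl mul1r EFinD leeD2l//.
rewrite integral_nneseries//.
apply: lime_le; first by apply: is_cvg_nneseries => j _ _; apply: integral_ge0 => x _; exact: f0.
apply: nearW => N.
apply: (@le_trans _ _ (\sum_(0 <= j < N) (K * expR 1 * expR (- 2^-1) ^+ j)%:E)%E).
  apply: lee_sum => j _.
  rewrite /f; under eq_integral do rewrite EFinM.
  rewrite ge0_integralZl//; last exact/measurable_EFinP/measurable_indic.
  rewrite integral_indic// setIT.
  apply: le_trans (lee_wpmul2l _ (PA j)) _; first by rewrite lee_fin expR_ge0.
  rewrite -EFinM lee_fin -expRM_natl mulrCA -mulrA ler_wpM2l// -!expRD ler_expR.
  by rewrite -natr1 -[j.+1%:R]natr1; lra.
rewrite sumEFin lee_fin -mulr_sumr.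
have q0 : 0 <= expR (- 2^-1) :> R := expR_ge0 _.
have q1 : expR (- 2^-1) <= 2 / 3 :> R.
  rewrite expRN -[leRHS]invrK lef_pV2 ?posrE ?expR_gt0// ?invr_gt0 ?divr_gt0//.
  have := expR_ge1Dx (2^-1 : R).
  have -> : (2 / 3 : R)^-1 = 3 / 2 by field.
  lra.
have geo : \sum_(0 <= j < N) expR (- 2^-1) ^+ j <= 3 :> R.
  suff : \sum_(0 <= j < N) expR (- 2^-1) ^+ j <= 3 - 3 * (2 / 3) ^+ N :> R.
    by have := exprn_ge0 N (_ : 0 <= 2 / 3 :> R); rewrite divr_ge0// => /(_ isT); lra.
  elim: N => [|N IH]; first by rewrite big_geq// expr0 mulr1 subrr.
  rewrite big_nat_recr//= exprS.
  have : expR (- 2^-1) ^+ N <= (2 / 3) ^+ N :> R by rewrite lerXn2r ?nnegrE// divr_ge0.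
  by lra.
rewrite mulrAC [3 * K]mulrC; apply: ler_wpM2r; first exact: expR_ge0.
by rewrite ler_wpM2l.
Qed.

(** Convexity between 0 and u, read off the tangent at theta u; in [mgf_bound] it moves a small
    theta from the exponent to a factor in front. *)
Lemma expR_convex (theta u : R) : 0 <= theta -> theta <= 1 ->
  expR (theta * u) <= 1 - theta + theta * expR u.
Proof.
move=> t0 t1; set a := theta * u.
have e0 := expR_gt0 a.
have H1 : expR a * (1 + (u - a)) <= expR u.
  by rewrite -[in leRHS](subrKC a u) expRD ler_wpM2l ?(ltW e0)// expR_ge1Dx.
have H2 : expR a * (1 - a) <= 1.
  rewrite -[leRHS]expR0 -(subrr a) expRD ler_wpM2l ?(ltW e0)//; exact: expR_ge1Dx.
have : expR a = theta * (expR a * (1 + (u - a))) + (1 - theta) * (expR a * (1 - a)).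
  by rewrite /a; ring.
move=> ->; move: (expR a * _) (expR a * _) H1 H2 => p q H1 H2.
have := ler_wpM2l t0 H1; have := ler_wpM2l (_ : 0 <= 1 - theta) H2.
by rewrite subr_ge0 => /(_ t1); lra.
Qed.

(** The linear term is kept exact, so that it integrates to 0 for a centred variable. *)
Lemma expR_le_add_square (y : R) : expR y <= y + expR (2 * y ^+ 2).
Proof.
have [y1|y1] := leP y 1.
  apply: (le_trans (expR_le_quadratic y1)).
  by have := expR_ge1Dx (2 * y ^+ 2); lra.
apply: (@le_trans _ _ (expR (2 * y ^+ 2))); last by rewrite lerDr; lra.
by rewrite ler_expR; nra.
Qed.

(* For small gamma one expands exp Y = Y + O (exp (2 Y^2)), whose first term has
   mean 0; for large gamma, Y <= gamma^2 tau^2 / 2 + V^2 / (2 tau^2). *)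
Lemma mgf_bound (V Y : T -> R) (gamma tau M : R) :
  measurable_fun [set: T] V -> (forall x, 0 <= V x) -> 0 < tau -> 0 <= M -> 0 <= gamma ->
  (\int[P]_x (expR (V x ^+ 2 / (2 * tau ^+ 2)))%:E <= M%:E)%E ->
  measurable_fun [set: T] Y -> (forall x, `|Y x| <= gamma * V x) ->
  P.-integrable [set: T] (EFin \o Y) -> (\int[P]_x (Y x)%:E = 0)%E ->
  (\int[P]_x (expR (Y x))%:E
    <= (expR ((4 * tau ^+ 2 * M + tau ^+ 2 / 2) * gamma ^+ 2))%:E)%E.
Proof.
move=> mV V0 tau0 M0 gamma0 HM mY YV iY EY.
pose W x := expR (V x ^+ 2 / (2 * tau ^+ 2)).
have mW : measurable_fun [set: T] W.
  apply: measurableT_comp => //.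
  by apply: measurable_funM => //; exact: measurable_funX.
have W0 x : 0 <= W x := expR_ge0 _.
have mEY : measurable_fun [set: T] (fun x => (expR (Y x))%:E).
  by apply/measurable_EFinP; exact: measurableT_comp.
have tau20 : 0 < tau ^+ 2 by rewrite exprn_gt0.
have YV2 x : Y x ^+ 2 <= gamma ^+ 2 * V x ^+ 2.
  rewrite -exprMn -real_normK ?num_real//.
  by rewrite lerXn2r ?nnegrE// mulr_ge0.
(* Chosen so that 2 gamma^2 V^2 = theta V^2 / (2 tau^2). *)
pose theta := 4 * tau ^+ 2 * gamma ^+ 2.
have theta0 : 0 <= theta by rewrite !mulr_ge0// ?sqr_ge0// ltW.
have [theta1|theta1] := leP theta 1.
  have iW : P.-integrable [set: T] (fun x => (1 + theta * W x)%:E).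
    apply/integrableP; split.
      apply/measurable_EFinP; apply: measurable_funD => //.
      by apply: measurable_funM.
    apply: (@le_lt_trans _ _ (1 + theta * M)%:E); last exact: ltry.
    under eq_integral => x _.
      rewrite gee0_abs; last by rewrite lee_fin addr_ge0// mulr_ge0.
      rewrite EFinD EFinM; over.
    rewrite ge0_integralD//; last 2 first.
    - by move=> x _; rewrite mule_ge0// lee_fin.
    - by apply: measurable_funeM; exact/measurable_EFinP.
    rewrite integral_cst//= probability_setT mule1 EFinD leeD2l//.
    rewrite ge0_integralZl//; last 2 first.
    - exact/measurable_EFinP.
    - by move=> x _; rewrite lee_fin.
    by rewrite [leRHS]EFinM; apply: lee_wpmul2l => //; rewrite lee_fin.
  apply: (@le_trans _ _ (\int[P]_x ((Y x)%:E + (1 + theta * W x)%:E))%E).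
    apply: ge0_le_integral => //.
    - by apply: emeasurable_funD; [exact: measurable_int iY|exact: measurable_int iW].
    - move=> x _; rewrite -EFinD lee_fin; apply: le_trans (expR_le_add_square _) _.
      rewrite lerD2l; apply: (@le_trans _ _ (expR (theta * (V x ^+ 2 / (2 * tau ^+ 2))))).
        rewrite ler_expR (_ : theta * _ = 2 * (gamma ^+ 2 * V x ^+ 2)); last first.
          by rewrite /theta; field; rewrite gt_eqF.
        by rewrite ler_wpM2l.
      apply: le_trans (expR_convex _ theta0 theta1) _; rewrite lerD2r; lra.
  rewrite integralD// EY add0e.
  apply: (@le_trans _ _ (1 + theta * M)%:E).
    under eq_integral do rewrite EFinD EFinM.
    rewrite ge0_integralD//; last 2 first.
    - by move=> x _; rewrite mule_ge0// lee_fin.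
    - by apply: measurable_funeM; exact/measurable_EFinP.
    rewrite integral_cst//= probability_setT mule1 EFinD leeD2l//.
    rewrite ge0_integralZl//; last 2 first.
    - exact/measurable_EFinP.
    - by move=> x _; rewrite lee_fin.
    by rewrite [leRHS]EFinM; apply: lee_wpmul2l => //; rewrite lee_fin.
  rewrite lee_fin; apply: le_trans (expR_ge1Dx _) _; rewrite ler_expR /theta.
  have : 0 <= tau ^+ 2 / 2 * gamma ^+ 2 by rewrite mulr_ge0 ?divr_ge0 ?sqr_ge0.
  lra.
apply: (@le_trans _ _ (\int[P]_x ((expR (gamma ^+ 2 * tau ^+ 2 / 2))%:E * (W x)%:E))%E).
  apply: ge0_le_integral => //.
  - by apply: measurable_funeM; exact/measurable_EFinP.
  - move=> x _; rewrite -EFinM lee_fin /W -expRD ler_expR.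
    apply: (le_trans (ler_norm _)); apply: (le_trans (YV x)).
    rewrite -subr_ge0.
    rewrite (_ : _ - _ = (gamma * tau ^+ 2 - V x) ^+ 2 / (2 * tau ^+ 2)); last first.
      by field; rewrite gt_eqF.
    by rewrite divr_ge0 ?sqr_ge0// mulr_ge0// ltW.
rewrite ge0_integralZl//; last 2 first.
- exact/measurable_EFinP.
- by move=> x _; rewrite lee_fin.
apply: (@le_trans _ _ ((expR (gamma ^+ 2 * tau ^+ 2 / 2))%:E * M%:E)%E).
  by apply: lee_wpmul2l => //; rewrite lee_fin expR_ge0.
rewrite -EFinM lee_fin.
apply: (@le_trans _ _ (expR (gamma ^+ 2 * tau ^+ 2 / 2) * expR M)).
  by rewrite ler_wpM2l ?expR_ge0//; have := expR_ge1Dx M; lra.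
rewrite -expRD ler_expR.
(* As theta > 1, the factor M, being at most exp M, is absorbed into exp (theta M). *)
have : M <= theta * M by rewrite ler_peMl// ltW.
by rewrite /theta; lra.
Qed.

End SubgaussianMoments.

(** * Almost sure growth and moments of the random sequence *)

Section SubgaussianSums.
Context {d : measure_display} {T : measurableType d} {R : realType}.
Local Notation C := (complex_field R).
Variable P : probability T R.

Lemma borel_cantelli (F : nat -> set T) (p : nat -> R) (S : R) :
  (forall n, measurable (F n)) -> (forall n, (P (F n) <= (p n)%:E)%E) ->
  (forall N, \sum_(0 <= n < N) p n <= S) ->
  {ae P, forall w, exists N, forall n, (N <= n)%N -> ~ F n w}.
Proof.
move=> mF Fp pS.
have p0 n : 0 <= p n by rewrite -lee_fin; apply: le_trans (Fp n).
exists (lim_sup_set F); split.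
- by apply: bigcap_measurableType => n _; apply: bigcup_measurable => j _.
- apply: lim_sup_set_cvg0 => //; apply: (@le_lt_trans _ _ S%:E); last exact: ltry.
  apply: lime_le; first by apply: is_cvg_nneseries.
  apply: nearW => N; apply: (@le_trans _ _ (\sum_(0 <= n < N) (p n)%:E)%E).
    by apply: lee_sum => i _; exact: Fp.
  by rewrite sumEFin lee_fin.
- move=> w /= nw N _; apply: contrapT => nF; apply: nw; exists N => n Nn Fn.
  by apply: nF; exists n.
Qed.

Variable X : nat -> T -> C.
Hypotheses (X_rv : forall n, complex_random_variable (X n))
  (X_independent : independent_seq P X) (X_centred : centred_seq P X)
  (X_subgaussian : subgaussian_seq P X).

Lemma measurable_modulus n : measurable_fun [set: T] (fun w => modulus (X n w)).
Proof. exact: (complex_rv_measurable (X_rv n) lipschitz_normc). Qed.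

Lemma measurable_Re_mul (c : C) n :
  measurable_fun [set: T] (fun w => complex.Re (c * X n w)).
Proof. exact: (complex_rv_measurable (X_rv n) (lipschitz_Re_mul c)). Qed.

(** By e^(-y) <= 1/y the tail at n + 1 is O((n + 1)^(-2)), and Borel-Cantelli applies. So crude a
    bound is enough because the decay of the coefficients pays for a factor n + 1. *)
Lemma modulus_linear_growth :
  {ae P, forall w, exists Cw : R, forall n, modulus (X n w) <= Cw * n.+1%:R}.
Proof.
have [K [tau [K0 tau0 tail]]] := X_subgaussian.
pose F n := [set w | n.+1%:R < modulus (X n w)].
have := @borel_cantelli F (fun n => K * tau ^+ 2 * (weight 1 n)^-1) (K * tau ^+ 2 * (1 + 1^-1)).
case.
- by move=> n; exact: measurable_superlevel (measurable_modulus n).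
- move=> n; apply: le_trans (tail _ _ _) _ => //.
  have w2 : weight 1 n = n.+1%:R ^+ 2 :> R.
    by rewrite /weight (_ : 1 + 1 = 2%:R) ?powR_mulrn// -natr1; ring.
  rewrite lee_fin -mulrA ler_wpM2l ?(ltW K0)// w2 expRN.
  have x0 : 0 < n.+1%:R ^+ 2 / tau ^+ 2 :> R by rewrite divr_gt0// exprn_gt0.
  have -> : tau ^+ 2 / n.+1%:R ^+ 2 = (n.+1%:R ^+ 2 / tau ^+ 2)^-1 by rewrite invf_div.
  rewrite lef_pV2 ?posrE ?expR_gt0//.
  by have := expR_ge1Dx (n.+1%:R ^+ 2 / tau ^+ 2 : R); lra.
- move=> N; rewrite -mulr_sumr ler_wpM2l ?sum_inv_weight//.
  by rewrite mulr_ge0 ?sqr_ge0 ?(ltW K0).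
move=> Bad [mB PB sub]; exists Bad; split => // w nw; apply: sub => -[N HN]; apply: nw.
pose S := \sum_(0 <= n < N) modulus (X n w).
have S0 : 0 <= S by apply: sumr_ge0 => n _; exact: modulus_ge0.
exists (1 + S) => n; have [Nn|nN] := leqP N n.
  have := HN n Nn; move=> /negP; rewrite -leNgt => H; apply: (le_trans H).
  by rewrite ler_peMl// lerDl.
apply: (@le_trans _ _ S).
  rewrite /S big_mkord (bigD1 (Ordinal nN))//= lerDl.
  by apply: sumr_ge0 => i _; exact: modulus_ge0.
apply: (@le_trans _ _ (1 + S)); first by rewrite lerDr.
by rewrite ler_peMr ?ler1n// addr_ge0.
Qed.

Lemma mgf_Re_mul : exists2 C0 : R, 0 < C0 & forall n (c : C),
  (\int[P]_w (expR (complex.Re (c * X n w)))%:E <= (expR (C0 * modulus c ^+ 2))%:E)%E.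
Proof.
have [K [tau [K0 tau0 tail]]] := X_subgaussian.
pose M : R := (1 + 3 * K) * expR 1.
have M0 : 0 < M by rewrite mulr_gt0 ?expR_gt0//; lra.
have HM n : (\int[P]_x (expR (modulus (X n x) ^+ 2 / (2 * tau ^+ 2)))%:E <= M%:E)%E.
  apply: exp_square_moment => //; [exact: measurable_modulus| | exact: ltW|exact: tail].
  by move=> x; exact: modulus_ge0.
have tau20 : 0 < tau ^+ 2 by rewrite exprn_gt0.
exists (4 * tau ^+ 2 * M + tau ^+ 2 / 2).
  by apply: addr_gt0; [apply: mulr_gt0 => //; apply: mulr_gt0|exact: divr_gt0].
move=> n c.
(* Integrability follows from v <= 1 + v^2 and 1 + y <= e^y with y = v^2 / (2 tau^2). It allows the
   mean of Re (c X_n) to be split into the vanishing means of Re X_n and Im X_n. *)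
have intX (f : C -> R) : lipschitz_modulus f 1 -> (forall z, `|f z| <= modulus z) ->
    P.-integrable [set: T] (EFin \o (f \o X n)).
  move=> fL fle; apply/integrableP; split.
    by apply/measurable_EFinP; exact: (complex_rv_measurable (X_rv n) fL).
  apply: (@le_lt_trans _ _ ((1 + 2 * tau ^+ 2) * M)%:E); last exact: ltry.
  have mW : measurable_fun [set: T] (fun x => (expR (modulus (X n x) ^+ 2 / (2 * tau ^+ 2)))%:E).
    apply/measurable_EFinP; apply: measurableT_comp => //.
    apply: measurable_funM => //; apply: measurable_funX; exact: measurable_modulus.
  apply: (@le_trans _ _ (\int[P]_x ((1 + 2 * tau ^+ 2)%:E * (expR (modulus (X n x) ^+ 2 / (2 * tau ^+ 2)))%:E))%E).
    apply: ge0_le_integral => //.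
    - apply: measurableT_comp => //; apply/measurable_EFinP.
      exact: (complex_rv_measurable (X_rv n) fL).
    - exact: measurable_funeM.
    - move=> x _; rewrite -EFinM lee_fin /=; apply: (le_trans (fle _)).
      have := modulus_ge0 (X n x); move: (modulus (X n x)) => v v0.
      set y := v ^+ 2 / (2 * tau ^+ 2).
      have vy : v ^+ 2 = 2 * tau ^+ 2 * y by rewrite /y; field; rewrite gt_eqF.
      have y0 : 0 <= y by rewrite divr_ge0 ?sqr_ge0// mulr_ge0// ltW.
      have := expR_ge1Dx y; move: (expR y) => e ey.
      have : v <= 1 + v ^+ 2 by nra.
      rewrite vy; move: (tau ^+ 2) tau20 => s s0 *; nra.
  rewrite ge0_integralZl//; last by rewrite lee_fin addr_ge0// mulr_ge0// ltW.
  rewrite [leRHS]EFinM; apply: lee_wpmul2l => //.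
  by rewrite lee_fin addr_ge0// mulr_ge0// ltW.
have lipRe : lipschitz_modulus (fun z : C => complex.Re z) 1.
  move=> z w; rewrite mul1r; apply: le_trans (normr_Re_le _).
  case: z => x y; case: w => x' y' /=; exact: ler_norm.
have iRe := intX _ lipRe normr_Re_le.
have iIm := intX _ lipschitz_Im normr_Im_le.
have YE w : complex.Re (c * X n w)
    = complex.Re c * complex.Re (X n w) - complex.Im c * complex.Im (X n w).
  by case: c => a b; case: (X n w) => x y.
have iY : P.-integrable [set: T] (EFin \o (fun w => complex.Re (c * X n w))).
  have -> : EFin \o (fun w => complex.Re (c * X n w)) = (fun w =>
      (complex.Re c)%:E * (complex.Re (X n w))%:E - (complex.Im c)%:E * (complex.Im (X n w))%:E)%E.
    by apply/funext => w; rewrite /= YE EFinB !EFinM.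
  by apply: integrableB => //; exact: integrableZl.
apply: (mgf_bound (measurable_modulus n) (fun x => modulus_ge0 _) tau0 (ltW M0) (modulus_ge0 c) (HM n)).
- exact: measurable_Re_mul.
- by move=> x; rewrite -modulusM; exact: normr_Re_le.
- exact: iY.
- under eq_integral do rewrite YE EFinB !EFinM.
  have [ERe EIm] := X_centred n; move: ERe EIm; rewrite unlock => ERe EIm.
  rewrite integralB//; [|exact: integrableZl|exact: integrableZl].
  rewrite !integralZl//.
  by rewrite [X in (_ * X - _)%E]ERe [X in (_ - _ * X)%E]EIm !mule0 sube0.
Qed.

Lemma independent_preimages (f : nat -> C -> R) (K : nat -> R) (N : nat)
    (B : nat -> set R) :
  (forall n, lipschitz_modulus (f n) (K n)) -> (forall n, measurable (B n)) ->
  P (\bigcap_(n in [set n | (n < N)%N]) ((fun w => f n (X n w)) @^-1` B n))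
  = (\prod_(0 <= n < N) fine (P ((fun w => f n (X n w)) @^-1` B n)))%:E.
Proof.
move=> fK mB.
pose J : {fset nat} := [fset n in iota 0 N]%fset.
have JE n : (n \in J) = (n < N)%N by rewrite !inE/= mem_iota.
have mfB n : borel_complex (f n @^-1` B n) by exact: borel_preimage_lipschitz (fK n) (mB n).
have := X_independent (J := J) (B := fun n => f n @^-1` B n) (fun n _ => mfB n).
have -> : [set` J] = [set n | (n < N)%N] by apply/seteqP; split => n /=; rewrite JE.
move=> ->; rewrite -prodEFin.
have -> : (\prod_(j <- J) P (X j @^-1` (f j @^-1` B j))
   = \prod_(j <- iota 0 N) P (X j @^-1` (f j @^-1` B j)))%E.
  apply: perm_big; apply: uniq_perm; rewrite ?fset_uniq ?iota_uniq// => n.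
  by rewrite JE mem_iota.
rewrite [in RHS]/index_iota subn0; apply: eq_bigr => n _.
by rewrite fineK// fin_num_measure//; exact: (X_rv n (mfB n)).
Qed.

End SubgaussianSums.

(** * Chernoff bounds for random sums *)

Section SubgaussianTails.
Context {d : measure_display} {T : measurableType d} {R : realType}.
Local Notation C := (complex_field R).
Variables (P : probability T R) (X : nat -> T -> C).
Hypotheses (X_rv : forall n, complex_random_variable (X n))
  (X_independent : independent_seq P X) (X_centred : centred_seq P X)
  (X_subgaussian : subgaussian_seq P X).

Lemma mgf_Re_sum : exists2 C0 : R, 0 < C0 & forall N (c : nat -> C),
  (\int[P]_w (expR (complex.Re (\sum_(0 <= n < N) c n * X n w)))%:E
    <= (expR (C0 * \sum_(0 <= n < N) modulus (c n) ^+ 2))%:E)%E.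
Proof.
have [C0 C00 mgf] := mgf_Re_mul X_rv X_centred X_subgaussian.
exists C0 => // N c.
pose Z n w := complex.Re (c n * X n w).
have e0 n : (0 <= \int[P]_w (expR (Z n w))%:E)%E.
  by apply: integral_ge0 => w _; rewrite lee_fin expR_ge0.
have efin n : (\int[P]_w (expR (Z n w))%:E)%E \is a fin_num.
  by rewrite ge0_fin_numE// (le_lt_trans (mgf n (c n)))// ltry.
have key := @integral_prod_expR _ _ _ P Z N (fun n => fine (\int[P]_w (expR (Z n w))%:E)%E).
under eq_integral do rewrite Re_sum expR_sum.
rewrite key.
- rewrite lee_fin mulr_sumr expR_sum; apply: ler_prod => n _.
  by rewrite fine_ge0//= -lee_fin fineK// mgf.
- by move=> n; exact: measurable_Re_mul X_rv _ _.
- move=> B mB; apply: (independent_preimages X_rv X_independent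
    (f := fun n z => complex.Re (c n * z)) (K := fun n => modulus (c n))) => // n.
  exact: lipschitz_Re_mul.
- by move=> n; rewrite fineK.
Qed.

Lemma measurable_Re_sum (c : nat -> C) N :
  measurable_fun [set: T] (fun w => complex.Re (\sum_(0 <= n < N) c n * X n w)).
Proof.
under eq_fun do rewrite Re_sum.
by apply: measurable_sum => n; exact: measurable_Re_mul X_rv _ _.
Qed.

Lemma chernoff_Re_sum : exists2 C0 : R, 0 < C0 & forall N (c : nat -> C) (t sigma : R),
  0 <= t -> 0 < sigma -> \sum_(0 <= n < N) modulus (c n) ^+ 2 <= sigma ^+ 2 ->
  (P [set w | (t * sigma < complex.Re (\sum_(0 <= n < N) c n * X n w))%R]
    <= (expR (- (t ^+ 2 / (4 * C0))))%:E)%E.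
Proof.
have [C0 C00 mgf] := mgf_Re_sum; exists C0 => // N c t sigma t0 s0 cs.
(* The minimiser of C0 lam^2 sigma^2 - lam t sigma, with minimum - t^2 / (4 C0). *)
pose lam := t / (2 * C0 * sigma).
have lam0 : 0 <= lam by rewrite divr_ge0// mulr_ge0 ?mulr_ge0 ?ltW.
pose S w := complex.Re (\sum_(0 <= n < N) c n * X n w).
pose A := [set w | t * sigma < S w].
have mA : measurable A by apply: measurable_superlevel; exact: measurable_Re_sum.
have scaled w : complex.Re (\sum_(0 <= n < N) (to_complex lam * c n) * X n w) = lam * S w.
  rewrite /S !Re_sum mulr_sumr; apply: eq_bigr => n _.
  by rewrite -mulrA; case: (c n * X n w) => x y /=; rewrite mul0r subr0.
have := mgf N (fun n => to_complex lam * c n).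
under eq_integral do rewrite scaled.
have -> : \sum_(0 <= n < N) modulus (to_complex lam * c n) ^+ 2
    = lam ^+ 2 * \sum_(0 <= n < N) modulus (c n) ^+ 2.
  rewrite mulr_sumr; apply: eq_bigr => n _.
  by rewrite modulusM modulus_to_complex exprMn real_normK ?num_real.
move=> bound.
have markov_bound : ((expR (lam * (t * sigma)))%:E * P A
    <= (expR (C0 * (lam ^+ 2 * \sum_(0 <= n < N) modulus (c n) ^+ 2)))%:E)%E.
  apply: le_trans bound.
  have -> : (P A = \int[P]_x (\1_A x)%:E)%E by rewrite integral_indic// setIT.
  rewrite -ge0_integralZl//; last by apply/measurable_EFinP; exact: measurable_indic.
  apply: ge0_le_integral => //.
  - by apply: measurable_funeM; apply/measurable_EFinP; exact: measurable_indic.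
  - apply/measurable_EFinP; apply: measurableT_comp => //.
    by apply: measurable_funM => //; exact: measurable_Re_sum.
  - move=> x _; rewrite -EFinM lee_fin indicE.
    case: (boolP (x \in A)) => [/set_mem xA|_]; last by rewrite mulr0 expR_ge0.
    by rewrite mulr1 ler_expR ler_wpM2l// ltW.
apply: (@le_trans _ _ (expR (- (lam * (t * sigma)))
    * expR (C0 * (lam ^+ 2 * \sum_(0 <= n < N) modulus (c n) ^+ 2)))%:E); last first.
  rewrite lee_fin -expRD ler_expR.
  apply: (@le_trans _ _ (- (lam * (t * sigma)) + C0 * (lam ^+ 2 * sigma ^+ 2))).
    by rewrite lerD2l ler_wpM2l ?(ltW C00)// ler_wpM2l ?sqr_ge0.
  rewrite le_eqVlt; apply/orP; left; apply/eqP; rewrite /lam; field.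
  by rewrite !gt_eqF.
rewrite EFinM; apply: le_trans (lee_wpmul2l _ markov_bound); last by rewrite lee_fin expR_ge0.
by rewrite muleA -EFinM -expRD addNr expR0 mul1e.
Qed.

(* Applied to the four multiples of the sum by i^k, the Chernoff bound controls
   the real and imaginary parts from both sides. *)
Lemma chernoff_sum : exists2 C0 : R, 0 < C0 & forall N (c : nat -> C) (t sigma : R),
  0 <= t -> 0 < sigma -> \sum_(0 <= n < N) modulus (c n) ^+ 2 <= sigma ^+ 2 ->
  exists2 F : set T, measurable F /\ (P F <= (4 * expR (- (t ^+ 2 / (4 * C0))))%:E)%E &
    forall w, ~ F w -> modulus (\sum_(0 <= n < N) c n * X n w) <= 2 * t * sigma.
Proof.
have [C0 C00 tail] := chernoff_Re_sum; exists C0 => // N c t sigma t0 s0 cs.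
pose i : C := (0 +i* 1)%C.
pose A (k : nat) := [set w | t * sigma < complex.Re (\sum_(0 <= n < N) i ^+ k * c n * X n w)].
have mA k : measurable (A k) by apply: measurable_superlevel; exact: measurable_Re_sum.
have modi : modulus i = 1 by rewrite /= expr0n expr1n add0r sqrtr1.
have PA k : (P (A k) <= (expR (- (t ^+ 2 / (4 * C0))))%:E)%E.
  apply: tail => //; apply: le_trans cs; apply: ler_sum => n _.
  by rewrite modulusM modulusX modi expr1n mul1r.
exists (\big[setU/set0]_(k < 4) A k).
  split; first by apply: bigsetU_measurable.
  apply: (le_trans (Boole_inequality P (A := A) (n := 4) (fun k _ => mA k))).
  rewrite !big_ord_recl big_ord0 adde0.
  apply: (@le_trans _ _ ((expR (- (t ^+ 2 / (4 * C0))))%:E + ((expR (- (t ^+ 2 / (4 * C0))))%:E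
     + ((expR (- (t ^+ 2 / (4 * C0))))%:E + (expR (- (t ^+ 2 / (4 * C0))))%:E)))%E).
    by do 3 (apply: leeD; first exact: PA); exact: PA.
  by rewrite -!EFinD lee_fin; lra.
move=> w nA.
have nAk (k : 'I_4) : complex.Re (i ^+ k * \sum_(0 <= n < N) c n * X n w) <= t * sigma.
  rewrite leNgt; apply/negP => H; apply: nA.
  rewrite -bigcup_mkord; exists k => //=; rewrite /A/=.
  rewrite (_ : \sum_(0 <= n < N) i ^+ k * c n * X n w = i ^+ k * \sum_(0 <= n < N) c n * X n w)//.
  by rewrite mulr_sumr; apply: eq_bigr => n _; rewrite mulrA.
apply: le_trans (modulus_le_ReIm _) _.
have i2 : i ^+ 2 = -1 by rewrite -[RHS](sqr_i R).
have := nAk (@Ordinal 4 0 isT); have := nAk (@Ordinal 4 1 isT).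
have := nAk (@Ordinal 4 2 isT); have := nAk (@Ordinal 4 3 isT).
rewrite [i ^+ (@Ordinal 4 3 isT)]exprS [i ^+ (@Ordinal 4 2 isT)]i2.
rewrite [i ^+ (@Ordinal 4 1 isT)]expr1 [i ^+ (@Ordinal 4 0 isT)]expr0 mulrN1 !mulNr !mul1r.
rewrite /i; case: (\sum_(_ <= _ < _) _) => x y /=.
rewrite mul0r mul1r sub0r opprK => H3 H2 H1 H0.
suff [Hx Hy] : `|x| <= t * sigma /\ `|y| <= t * sigma by lra.
by split; rewrite ler_norml; apply/andP; split; lra.
Qed.

End SubgaussianTails.

(** * Polar nets and the discretisation error *)

Section PolarNet.
Context {R : realType}.
Local Notation C := (complex_field R).
Implicit Types (z w : C) (a b : nat -> C).

(* Modulus and direction are both rounded towards zero, so that the net points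
   have at most the modulus of the point that they approximate. *)
Definition net_point (L : nat)
    (j : nat * nat * nat * bool * bool) : C :=
  let: (m, p, q, e, f) := j in
  to_complex (expR (m%:R / L%:R)) *
    ((-1) ^+ e * (p%:R / L%:R) +i* ((-1) ^+ f * (q%:R / L%:R)))%C.

(** Geometric spacing of the radii keeps the number of points polynomial in L and X, although the
    disc has radius e^X; the approximation error is then relative to |z|. *)
Definition polar_net (L X : nat) : seq C :=
  [seq net_point L (val j.1.1.1.1, val j.1.1.1.2, val j.1.1.2, j.1.2, j.2) |
    j <- enum {: 'I_(L * X).+1 * 'I_L.+1 * 'I_L.+1 * bool * bool}].

Lemma size_polar_net L X : size (polar_net L X) = ((L * X).+1 * L.+1 * L.+1 * 4)%N.
Proof.
by rewrite size_map -cardE !card_prod !card_ord !card_bool -!mulnA.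
Qed.

Lemma round_toward_zero (L : nat) (u : R) : (0 < L)%N -> `|u| <= 1 ->
  exists e : bool, exists2 p : nat, (p < L.+1)%N &
    let u' := (-1) ^+ e * (p%:R / L%:R) in `|u'| <= `|u| /\ `|u - u'| <= L%:R^-1.
Proof.
move=> L0 u1; have L0' : 0 < L%:R :> R by rewrite ltr0n.
have y0 : 0 <= L%:R * `|u| by rewrite mulr_ge0.
have /andP[pl pu] := truncn_itv y0.
set p := Num.truncn _ in pl pu.
have pL : `|u| - p%:R / L%:R <= L%:R^-1.
  rewrite lerBlDr -[X in X + _]mul1r -mulrDl ler_pdivlMr// mulrC [leRHS]addrC natr1.
  exact: ltW.
have pu' : p%:R / L%:R <= `|u| by rewrite ler_pdivrMr// mulrC.
have p0 : 0 <= p%:R / L%:R :> R by rewrite divr_ge0.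
exists (u < 0), p => /=.
  rewrite ltnS -(ler_nat R); apply: (le_trans pl); by rewrite ler_piMr.
split; first by rewrite normrM normr_sign mul1r ger0_norm.
have -> : u - (-1) ^+ (u < 0)%R * (p%:R / L%:R) = (-1) ^+ (u < 0)%R * (`|u| - p%:R / L%:R).
  by rewrite mulrBr -numEsign.
by rewrite normrM normr_sign mul1r ger0_norm// subr_ge0.
Qed.

Lemma polar_net_dense (L X : nat) (x : R) z : (0 < L)%N -> 0 <= x -> x <= X%:R ->
  modulus z = expR x ->
  exists2 w, w \in polar_net L X &
    modulus w <= expR x /\ modulus (z - w) <= 3 * expR x / L%:R.
Proof.
move=> L0 x0 xX zx; have L0' : 0 < L%:R :> R by rewrite ltr0n.
have r0 : 0 < expR x := expR_gt0 x.
pose z' : C := z / to_complex (expR x).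
have zE : z = to_complex (expR x) * z'.
  rewrite /z' mulrCA divff ?mulr1//.
  by apply/eqP => /(congr1 (@complex.Re R))/= H; move: r0; rewrite H ltxx.
have mz' : modulus z' = 1.
  have := zx; rewrite {1}zE modulusM modulus_to_complex gtr0_norm//.
  by move=> /(canRL (mulKf (lt0r_neq0 r0))) ->; rewrite mulVf// gt_eqF.
have uv1 := normr_Re_le z'; have vv1 := normr_Im_le z'; rewrite mz' in uv1 vv1.
have [e [p pL [pu pd]]] := round_toward_zero L0 uv1.
have [f [q qL [qu qd]]] := round_toward_zero L0 vv1.
have y0 : 0 <= L%:R * x by rewrite mulr_ge0.
have /andP[ml mu] := truncn_itv y0.
set m := Num.truncn _ in ml mu.
have mLX : (m < (L * X).+1)%N.
  rewrite ltnS -(ler_nat R) natrM; apply: (le_trans ml).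
  by rewrite ler_wpM2l.
set u' := _ * (p%:R / _) in pu pd; set v' := _ * (q%:R / _) in qu qd.
pose d : C := (u' +i* v')%C.
have d1 : modulus d <= 1.
  rewrite -mz'; case: z' {mz' zE uv1 vv1} pu qu {pd qd} => uu vv /= pu qu.
  rewrite ler_wsqrtr// -[u' ^+ 2]real_normK ?num_real// -[v' ^+ 2]real_normK ?num_real//.
  rewrite -[uu ^+ 2]real_normK ?num_real// -[vv ^+ 2]real_normK ?num_real//.
  by rewrite lerD// lerXn2r ?nnegrE.
have dd : modulus (z' - d) <= 2 / L%:R.
  apply: le_trans (modulus_le_ReIm _) _.
  case: z' {mz' zE uv1 vv1 pu qu} pd qd => uu vv /= pd qd; lra.
pose rho := expR (m%:R / L%:R) : R.
have rho0 : 0 < rho := expR_gt0 _.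
have rhor : rho <= expR x by rewrite ler_expR ler_pdivrMr// mulrC.
have rrho : expR x - rho <= expR x / L%:R.
  have : x - L%:R^-1 <= m%:R / L%:R.
    rewrite lerBlDr -[X in _ + X]mul1r -mulrDl ler_pdivlMr// mulrC natr1; exact: ltW.
  rewrite -ler_expR expRD -/rho => H.
  have := ler_wpM2l (ltW r0) (expR_ge1Dx (- L%:R^-1 : R)).
  by rewrite mulrDr mulr1 mulrN; lra.
exists (to_complex rho * d).
  apply/mapP; exists (Ordinal mLX, Ordinal pL, Ordinal qL, e, f) => //=.
  by rewrite mem_enum.
split.
  by rewrite modulusM modulus_to_complex gtr0_norm// -[leRHS]mulr1 ler_pM// ?(ltW rho0)// modulus_ge0.
have -> : z - to_complex rho * d
    = to_complex (expR x - rho) * d + to_complex (expR x) * (z' - d).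
  have -> : to_complex (expR x - rho) = to_complex (expR x) - to_complex rho.
    by rewrite /to_complex rmorphB.
  have gen (F : comNzRingType) (p1 p2 q1 q2 : F) :
      p1 * q1 - p2 * q2 = (p1 - p2) * q2 + p1 * (q1 - q2) by ring.
  by rewrite {1}zE; exact: (gen C).
apply: le_trans (modulus_triangle _ _) _; rewrite !modulusM !modulus_to_complex.
rewrite ger0_norm ?subr_ge0// gtr0_norm//.
(* One share of e^x / L comes from rounding the radius, two from the coordinates of the
   direction. *)
have -> : 3 * expR x / L%:R = expR x / L%:R * 1 + expR x * (2 / L%:R).
  by field; rewrite gt_eqF.
apply: lerD; first by apply: ler_pM; rewrite ?subr_ge0 ?modulus_ge0.
by rewrite ler_wpM2l ?(ltW r0).
Qed.

(** Truncation costs Cw. Replacing z by w costs two factors n + 1, one from the growth of the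
    coefficients and one from |z^n - w^n|; hence the second moment W. *)
Lemma power_series_approx a b z w (Cw r L W : R) (N : nat) :
  (forall n, modulus (b n) <= Cw * n.+1%:R * modulus (a n)) -> 0 <= Cw -> 0 < L ->
  fast_decay (fun n => modulus (b n)) ->
  modulus z = r -> modulus w <= r -> modulus (z - w) <= 3 * r / L ->
  (forall M, \sum_(N <= n < M) n.+1%:R * (modulus (a n) * r ^+ n) <= 1) ->
  \sum_(0 <= n < N) n.+1%:R ^+ 2 * (modulus (a n) * r ^+ n) <= W ->
  modulus (power_series_sum b z)
    <= Cw * (1 + 3 * W / L) + modulus (\sum_(0 <= n < N) b n * w ^+ n).
Proof.
move=> ab Cw0 L0 bdec zr wr zw tail mom.
have r0 : 0 <= r by rewrite -zr modulus_ge0.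
have bX n : modulus (b n) * r ^+ n <= Cw * (n.+1%:R * (modulus (a n) * r ^+ n)).
  by rewrite [leRHS]mulrA [leRHS]mulrA ler_wpM2r ?exprn_ge0.
have T1 : modulus (power_series_sum b z - power_series b z N) <= Cw.
  apply: series_tail; first exact: fast_decay_cvg.
  move=> M; rewrite -[leRHS]mulr1; apply: le_trans (ler_wpM2l Cw0 (tail M)).
  rewrite mulr_sumr; apply: ler_sum => n _; rewrite modulusM modulusX zr; exact: bX.
have T2 : modulus (power_series b z N - \sum_(0 <= n < N) b n * w ^+ n) <= Cw * (3 * W / L).
  rewrite /power_series /series/= -sumrB; apply: le_trans (modulus_sum _ _) _.
  apply: (@le_trans _ _ (\sum_(0 <= n < N) Cw * (3 / L) * (n.+1%:R ^+ 2 * (modulus (a n) * r ^+ n)))).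
    apply: ler_sum => n _; rewrite -mulrBr modulusM.
    have zwn : modulus (z ^+ n - w ^+ n) <= n.+1%:R * r ^+ n * (3 / L).
      case: n => [|n].
        by rewrite !expr0 subrr modulus0 !mul1r divr_ge0// ltW.
      have zr' : modulus z <= r by rewrite zr.
      apply: (le_trans (modulus_exprB n zr' wr)).
      apply: (@le_trans _ _ (n.+2%:R * r ^+ n * (3 * r / L))).
        apply: ler_pM => //; rewrite ?mulr_ge0 ?modulus_ge0 ?exprn_ge0//.
        by rewrite ler_wpM2r ?exprn_ge0// ler_nat.
      by rewrite le_eqVlt; apply/orP; left; apply/eqP; rewrite exprSr; ring.
    apply: (@le_trans _ _ (modulus (b n) * (n.+1%:R * r ^+ n * (3 / L)))).
      by rewrite ler_wpM2l ?modulus_ge0.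
    have -> : modulus (b n) * (n.+1%:R * r ^+ n * (3 / L))
        = modulus (b n) * r ^+ n * (n.+1%:R * (3 / L)) by ring.
    have -> : Cw * (3 / L) * (n.+1%:R ^+ 2 * (modulus (a n) * r ^+ n))
        = Cw * (n.+1%:R * (modulus (a n) * r ^+ n)) * (n.+1%:R * (3 / L)) by ring.
    by rewrite ler_wpM2r// mulr_ge0// divr_ge0// ltW.
  rewrite -mulr_sumr; apply: le_trans (ler_wpM2l _ mom) _.
    by rewrite mulr_ge0// divr_ge0// ltW.
  by rewrite le_eqVlt; apply/orP; left; apply/eqP; ring.
set S := \sum_(0 <= n < N) b n * w ^+ n in T2 *.
have -> : power_series_sum b z
   = (power_series_sum b z - power_series b z N) + (power_series b z N - S) + S.
  by rewrite addrA !subrK.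
apply: le_trans (modulus_triangle _ _) _; rewrite lerD2r.
apply: le_trans (modulus_triangle _ _) _.
by rewrite mulrDr mulr1 lerD.
Qed.

End PolarNet.

(** * Truncation, mesh and net size of a level *)

Section Levels.
Context {R : realType}.
Local Notation C := (complex_field R).

Lemma fast_decay_tail (A : nat -> R) (r : R) :
  (forall n, 0 <= A n) -> fast_decay A -> 0 <= r ->
  exists N, forall M, \sum_(N <= n < M) n.+1%:R * (A n * r ^+ n) <= 1.
Proof.
move=> A0 Adec r0; have [K K0 AK] := fast_decay_moment 1 A0 Adec r0.
pose t n := n.+1%:R * (A n * r ^+ n).
have t0 n : 0 <= t n by rewrite !mulr_ge0// exprn_ge0.
have tK N : \sum_(0 <= n < N) t n <= K.
  by apply: le_trans (AK N); apply: ler_sum => n _; rewrite /t expr1 mulrA.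
have ct : cvgn (series t) := bounded_series_cvg t0 tK.
have /cvgrPdist_lt/(_ 1 ltr01)[N _ HN] := ct.
exists N => M.
have nd : nondecreasing_seq (series t) by apply: nondecreasing_series => n _ _; exact: t0.
have tM : series t M <= limn (series t) := nondecreasing_cvgn_le nd ct M.
have := HN N (leqnn N) => /ltr_normlP[_ H].
have [MN|NM] := leqP M N; first by rewrite big_geq.
rewrite -(@sub_series_geq _ t N M (ltnW NM)).
by move: tM H; move: (limn _) (series t M) (series t N) => *; lra.
Qed.

Lemma fast_decay_linear_growth (a b : nat -> C) (Cw : R) :
  fast_decay (fun n => modulus (a n)) -> 0 <= Cw ->
  (forall n, modulus (b n) <= Cw * n.+1%:R * modulus (a n)) ->
  fast_decay (fun n => modulus (b n)).
Proof.
move=> adec Cw0 ab r r0.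
have [|K K0 aK] := fast_decay_moment 1 _ adec r0; first by move=> n; exact: modulus_ge0.
exists (Cw * K) => n; apply: (@le_trans _ _ (Cw * n.+1%:R * modulus (a n) * r ^+ n)).
  by rewrite ler_wpM2r ?exprn_ge0.
rewrite -!mulrA ler_wpM2l//; apply: le_trans (aK n.+1).
rewrite big_nat_recr//= expr1 mulrA lerDr.
by apply: sumr_ge0 => m _; rewrite !mulr_ge0 ?modulus_ge0 ?exprn_ge0.
Qed.

Lemma weight_le_expR (u : R) k : 0 < u -> weight u k <= expR ((1 + u) * k%:R).
Proof.
move=> u0; rewrite /weight.
have -> : expR ((1 + u) * k%:R) = expR k%:R `^ (1 + u).
  by rewrite /powR gt_eqF ?expR_gt0// expRK.
apply: ge0_ler_powR; rewrite ?nnegrE ?expR_ge0//; first by lra.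
by rewrite -natr1 addrC expR_ge1Dx.
Qed.

(** The cube is the one in [moment_bound] with D = e^(k/2) + 1. It grows at most geometrically in k,
    so a mesh B^(-k) with B at least this ratio compensates for it. *)
Lemma step_ratio_le (u : R) k : 0 < u ->
  ((scale_root k + 1) / step_size u k) ^+ 3 <= 8 * expR (3 * (2 + u)) ^+ k :> R.
Proof.
move=> u0; rewrite /step_size invrK.
have s1 := @scale_root_ge1 R k; have w1 := weight_ge1 k u0.
have w2 := weight_le_expR k u0.
have H : (scale_root k + 1) * (scale_root k * weight u k) <= 2 * expR ((2 + u) * k%:R).
  apply: (@le_trans _ _ (2 * (scale_root k ^+ 2 * weight u k))).
    move: (scale_root k) (weight u k) s1 w1 => s w s1 w1.
    have : 0 <= s * w * (s - 1) by rewrite !mulr_ge0//; lra.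
    by rewrite expr2; lra.
  rewrite ler_wpM2l// scale_rootX2 (_ : (2 + u) * k%:R = k%:R + (1 + u) * k%:R); last by ring.
  by rewrite expRD ler_wpM2l ?expR_ge0.
have H0 : 0 <= (scale_root k + 1) * (scale_root k * weight u k).
  by rewrite !mulr_ge0//; lra.
apply: (@le_trans _ _ ((2 * expR ((2 + u) * k%:R)) ^+ 3)).
  by rewrite lerXn2r ?nnegrE// mulr_ge0 ?expR_ge0.
rewrite exprMn -!expRM_natl (_ : 2 ^+ 3 = 8); last by ring.
rewrite ler_wpM2l// ler_expR le_eqVlt; apply/orP; left; apply/eqP; ring.
Qed.

(** The size is exponential in k only, so a Chernoff bound with t of order sqrt k can beat it. *)
Lemma size_polar_net_le (c B k : nat) : (0 < B)%N ->
  (size (polar_net (B ^ k) (c * B ^ k) : seq C) <= 16 * c.+1 * (B ^ 4) ^ k)%N.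
Proof.
move=> B0; rewrite size_polar_net.
have L0 : (0 < B ^ k)%N by rewrite expn_gt0 B0.
rewrite -expnM mulnC [(4 * k)%N]mulnC expnM.
move: (B ^ k)%N L0 => L L0.
have H1 : ((L * (c * L)).+1 <= c.+1 * L ^ 2)%N.
  by rewrite mulnCA -mulnn mulSn addnC -addn1 leq_add// muln_gt0 L0.
have H2 : (L.+1 <= 2 * L)%N by rewrite mul2n -addnn -addn1 leq_add2l.
apply: (@leq_trans (4 * (c.+1 * L ^ 2 * (2 * L) * (2 * L)))).
  by rewrite leq_mul2l; apply/orP; right; rewrite leq_mul// leq_mul.
rewrite leq_eqVlt; apply/orP; left; apply/eqP; ring.
Qed.

End Levels.

(** * Union bound over a net *)

Section LevelEvents.
Context {d : measure_display} {T : measurableType d} {R : realType}.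
Local Notation C := (complex_field R).
Variables (P : probability T R) (X : nat -> T -> C).
Hypotheses (X_rv : forall n, complex_random_variable (X n))
  (X_independent : independent_seq P X) (X_centred : centred_seq P X)
  (X_subgaussian : subgaussian_seq P X).

Lemma net_event : exists2 C0 : R, 0 < C0 & forall N (a : nat -> C) (s : seq C) (t : R),
  0 <= t ->
  exists F : set T, [/\ measurable F,
    (P F <= ((size s)%:R * (4 * expR (- (t ^+ 2 / (4 * C0)))))%:E)%E &
    forall w, ~ F w -> forall z, z \in s ->
      modulus (\sum_(0 <= n < N) a n * X n w * z ^+ n)
        <= 2 * t * Num.sqrt (1 + \sum_(0 <= n < N) (modulus (a n) * modulus z ^+ n) ^+ 2)].
Proof.
have [C0 C00 tail] := chernoff_sum X_rv X_independent X_centred X_subgaussian.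
exists C0 => // N a s t t0; elim: s => [|z s [F [mF PF HF]]].
  by exists set0; split => //; rewrite ?measure0 ?mul0r.
(* The summand 1 keeps sigma positive even when all terms vanish at z. *)
pose S := 1 + \sum_(0 <= n < N) (modulus (a n) * modulus z ^+ n) ^+ 2.
have S0 : 0 < S by rewrite ltr_wpDr//; apply: sumr_ge0 => n _; exact: sqr_ge0.
have sS : 0 < Num.sqrt S by rewrite sqrtr_gt0.
have [|G [mG PG] HG] := tail N (fun n => a n * z ^+ n) t _ t0 sS.
  rewrite sqr_sqrtr ?(ltW S0)// /S.
  under eq_bigr do rewrite modulusM modulusX.
  by rewrite lerDr.
exists (G `|` F); split; first exact: measurableU.
- apply: (le_trans (measureU2 P mG mF)); rewrite -[size _]add1n natrD mulrDl mul1r EFinD.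
  exact: leeD.
- move=> w nGF z'; rewrite inE => /predU1P[->|zs].
    have := HG w (fun Gw => nGF (or_introl Gw)).
    by under eq_bigr do rewrite mulrAC.
  by apply: HF => // Fw; apply: nGF; right.
Qed.

End LevelEvents.

(** * Conversion of level quantities into log mu and log log mu *)

Section FinalEstimate.
Context {R : realType}.

(** The random Cw occurs only in the first summand, where e^(k/4) <= g^(1/4) absorbs it; the
    constant on the right is therefore free of Cw. *)
Lemma final_estimate (delta g Cw K tau0 : R) (k : nat) :
  0 < delta -> (0 < k)%N -> 0 <= Cw -> 0 <= tau0 -> 0 <= K ->
  expR k%:R <= g -> Cw * (1 + K) <= expR (k%:R / 4) ->
  Cw * (1 + K * expR g) + 2 * (tau0 * Num.sqrt k%:R)
    * Num.sqrt (1 + K / step_size (2 * delta) k * expR g ^+ 2)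
  <= (1 + 2 * tau0 * Num.sqrt (1 + K) * 2 `^ (1 + delta)) * expR g
       * g `^ (1 / 4) * ln g `^ (1 + delta).
Proof.
move=> d0 k0 Cw0 t0 K0 kg CK.
have g0 : 0 < g := lt_le_trans (expR_gt0 _) kg.
have klng : k%:R <= ln g by rewrite -ler_expR lnK.
have k1 : 1 <= k%:R :> R by rewrite ler1n.
have lng1 : 1 <= ln g by apply: le_trans klng.
have mu1 : 1 <= expR g by rewrite -[leLHS]expR0 ler_expR ltW.
have mu0 : 0 < expR g := expR_gt0 _.
set q := g `^ (1 / 4); set l := ln g `^ (1 + delta).
have q_ge : expR (k%:R / 4) <= q.
  by rewrite /q /powR gt_eqF// ler_expR mulrC mul1r ler_pM2l ?invr_gt0.
have q0 : 0 <= q := powR_ge0 _ _.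
have l1 : 1 <= l.
  rewrite /l -[leLHS](powRr0 (ln g)); apply: ler_powR => //; lra.
have first_term : Cw * (1 + K * expR g) <= expR g * q * l.
  apply: (@le_trans _ _ (Cw * (1 + K) * expR g)).
    rewrite -mulrA ler_wpM2l// mulrDl mul1r lerD2r//.
  apply: (@le_trans _ _ (q * expR g)).
    by rewrite ler_pM2r//; exact: le_trans q_ge.
  by rewrite [q * _]mulrC ler_peMr// mulr_ge0// ltW.
have u0 : 0 < 2 * delta by lra.
have h0 := step_size_gt0 k u0.
have s0 : 0 < scale_root k :> R := lt_le_trans ltr01 (scale_root_ge1 _).
have w0 : 0 < weight (2 * delta) k := lt_le_trans ltr01 (weight_ge1 k u0).
have sqrt_le : Num.sqrt (1 + K / step_size (2 * delta) k * expR g ^+ 2)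
    <= expR g * Num.sqrt (1 + K) * (Num.sqrt (scale_root k) * Num.sqrt (weight (2 * delta) k)).
  have -> : expR g = Num.sqrt (expR g ^+ 2) by rewrite sqrtr_sqr gtr0_norm.
  rewrite sqr_sqrtr ?sqr_ge0//.
  rewrite -!sqrtrM ?sqr_ge0 ?(ltW s0)//; last by rewrite mulr_ge0 ?sqr_ge0//; lra.
  apply: ler_wsqrtr; rewrite /step_size invrK.
  have sw1 : 1 <= scale_root k * weight (2 * delta) k.
    by rewrite mulr_ege1 ?scale_root_ge1 ?weight_ge1.
  have mu21 : 1 <= expR g ^+ 2 by rewrite exprn_ege1.
  move: (expR g ^+ 2) (scale_root k * _) mu21 sw1 => m sw m1 sw1.
  have : 1 <= m * sw by rewrite mulr_ege1.
  by clear -K0; nra.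
have sqrt_s : Num.sqrt (scale_root k) <= q.
  apply: le_trans q_ge.
  have -> : scale_root k = expR (k%:R / 4) ^+ 2 :> R.
    by rewrite -expRM_natl /scale_root; congr expR; field.
  by rewrite sqrtr_sqr gtr0_norm ?expR_gt0.
(* The product under the root is at most (k + 1)^(2 + 2 delta), and k + 1 <= 2 k <= 2 ln g because k
   >= 1; hence the factor 2^(1 + delta). *)
have sqrt_w : Num.sqrt k%:R * Num.sqrt (weight (2 * delta) k) <= 2 `^ (1 + delta) * l.
  rewrite -sqrtrM//.
  apply: (@le_trans _ _ (k.+1%:R `^ (1 + delta))).
    have -> : k.+1%:R `^ (1 + delta) = Num.sqrt (k.+1%:R * weight (2 * delta) k).
      rewrite /weight -powR12_sqrt; last by rewrite mulr_ge0// powR_ge0.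
      rewrite powRM ?powR_ge0// -powRrM -powRD; last by rewrite pnatr_eq0 implybT.
      by congr powR; field.
    by apply: ler_wsqrtr; rewrite ler_pM2r// ler_nat.
  rewrite -powRM//; last by lra.
  by apply: ge0_ler_powR; rewrite ?nnegrE ?mulr_ge0//; lra.
have second_term : 2 * (tau0 * Num.sqrt k%:R)
    * Num.sqrt (1 + K / step_size (2 * delta) k * expR g ^+ 2)
    <= 2 * tau0 * Num.sqrt (1 + K) * 2 `^ (1 + delta) * (expR g * q * l).
  apply: (@le_trans _ _ (2 * (tau0 * Num.sqrt k%:R) *
    (expR g * Num.sqrt (1 + K) * (Num.sqrt (scale_root k) * Num.sqrt (weight (2 * delta) k))))).
    by rewrite ler_wpM2l// !mulr_ge0// sqrtr_ge0.
  rewrite [leLHS](_ : _ = 2 * tau0 * Num.sqrt (1 + K) * expR g *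
    (Num.sqrt (scale_root k) * (Num.sqrt k%:R * Num.sqrt (weight (2 * delta) k)))); last by ring.
  rewrite [leRHS](_ : _ = 2 * tau0 * Num.sqrt (1 + K) * expR g *
    (q * (2 `^ (1 + delta) * l))); last by ring.
  rewrite ler_wpM2l ?mulr_ge0 ?sqrtr_ge0 ?(ltW mu0)//.
  by apply: ler_pM => //; rewrite ?mulr_ge0 ?sqrtr_ge0.
rewrite [leRHS](_ : _ = expR g * q * l
  + 2 * tau0 * Num.sqrt (1 + K) * 2 `^ (1 + delta) * (expR g * q * l)); last by ring.
exact: lerD.
Qed.

End FinalEstimate.

(** * The bound at a single radius *)

Section LevelBound.
Context {R : realType}.
Local Notation C := (complex_field R).
Variables (a b : nat -> C) (n0 : nat) (Cw u : R).
Local Notation A := (fun n => modulus (a n)).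
Local Notation g := (log_max_term A).
Hypotheses (a_decay : fast_decay A) (an0_gt0 : 0 < A n0).
Hypotheses (u_gt0 : 0 < u) (Cw_ge0 : 0 <= Cw)
  (b_le : forall n, modulus (b n) <= Cw * n.+1%:R * modulus (a n)).

Let A_ge0 n : 0 <= A n. Proof. exact: modulus_ge0. Qed.

Lemma level_bound (k B X N : nat) (x t : R) z :
  expR (3 * (2 + u)) <= B%:R -> 0 <= x -> x <= X%:R -> 0 <= t ->
  let h := step_size u k in
  g (x + h) - g x <= 1 + (g x - g (x - h)) ->
  g (x + h) - g x <= scale_root k + 1 ->
  (forall M, \sum_(N <= n < M) n.+1%:R * (A n * expR X%:R ^+ n) <= 1) ->
  (forall w, w \in polar_net (B ^ k) X ->
    modulus (\sum_(0 <= n < N) b n * w ^+ n)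
      <= 2 * t * Num.sqrt (1 + \sum_(0 <= n < N) (A n * modulus w ^+ n) ^+ 2)) ->
  modulus z = expR x ->
  modulus (power_series_sum b z)
    <= Cw * (1 + 1536 * expR 2 * expR (g x))
       + 2 * t * Num.sqrt (1 + 1536 * expR 2 / h * expR (g x) ^+ 2).
Proof.
move=> HB x0 xX t0 h G1 G2 tail net zx.
have h0 : 0 < h := step_size_gt0 k u_gt0.
have h1 : h <= 1 := step_size_le1 k u_gt0.
have s1 := @scale_root_ge1 R k.
have B0 : (0 < B)%N by rewrite -(ltr_nat R); apply: lt_le_trans HB; exact: expR_gt0.
have L0 : (0 < B ^ k)%N by rewrite expn_gt0 B0.
have [w wnet [wx zw]] := polar_net_dense L0 x0 xX zx.
have muE : max_term A x = expR (g x) := max_termE a_decay an0_gt0 x.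
(* N belongs to the outer radius e^X, where the tail dominates that of every smaller radius. *)
have tail' M : \sum_(N <= n < M) n.+1%:R * (A n * expR x ^+ n) <= 1.
  apply: le_trans (tail M); apply: ler_sum => n _.
  by rewrite ler_wpM2l// ler_wpM2l// lerXn2r ?nnegrE ?expR_ge0// ler_expR.
have D1 : 1 <= scale_root k + 1 :> R by rewrite lerDr (le_trans ler01).
have mom := moment_bound a_decay an0_gt0 N h0 h1 D1 G2.
have var := variance_bound A_ge0 a_decay an0_gt0 N h0 h1 G1.
have bdec := fast_decay_linear_growth a_decay Cw_ge0 b_le.
have L0' : 0 < (B ^ k)%:R :> R by rewrite ltr0n.
apply: (le_trans (power_series_approx b_le Cw_ge0 L0' bdec zx wx zw tail' mom)).
apply: lerD.
  rewrite ler_wpM2l// lerD2l ler_pdivrMr// muE.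
  have := step_ratio_le k u_gt0.
  have : expR (3 * (2 + u)) ^+ k <= (B ^ k)%:R by rewrite natrX lerXn2r ?nnegrE ?expR_ge0.
  rewrite -/h; move: (expR (3 * (2 + u)) ^+ k) (_ ^+ 3) (B ^ k)%:R => e v L eL ve.
  have vL : v <= 8 * L by apply: (le_trans ve); rewrite ler_wpM2l.
  (* 1536 = 3 x 64 x 8: 3 from the net, 64 from [moment_bound], 8 from [step_ratio_le]. The variance
     term is rounded up to the same constant. *)
  rewrite [leLHS](_ : _ = 192 * expR 2 * expR (g x) * v); last by ring.
  rewrite [leRHS](_ : _ = 192 * expR 2 * expR (g x) * (8 * L)); last by ring.
  by rewrite ler_wpM2l// !mulr_ge0 ?expR_ge0.
apply: (le_trans (net w wnet)).
rewrite ler_wpM2l ?mulr_ge0//; apply: ler_wsqrtr; rewrite lerD2l.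
(* Rounding towards zero matters here: the variance at w is at most that at x, where the second
   difference is controlled, whereas nothing is known about it at log |w|. *)
apply: (@le_trans _ _ (\sum_(0 <= n < N) (A n * expR x ^+ n) ^+ 2)).
  apply: ler_sum => n _.
  rewrite lerXn2r ?nnegrE ?mulr_ge0 ?exprn_ge0 ?expR_ge0 ?modulus_ge0//.
  by rewrite ler_wpM2l// lerXn2r ?nnegrE ?expR_ge0 ?modulus_ge0.
apply: (le_trans var); rewrite muE ler_wpM2r ?exprn_ge0 ?expR_ge0//.
apply: ler_wpM2r; first by rewrite invr_ge0 ltW.
by apply: ler_wpM2r; rewrite ?expR_ge0// ler_nat.
Qed.

End LevelBound.

(** * Choice of the constants and assembly of the levels *)

Theorem theorem1p1 (R : realType) (d : measure_display) (T : measurableType d)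
    (P : probability T R) (a : nat -> complex_field R)
    (X : nat -> T -> complex_field R)
    (f_entire : defines_entire a)
    (f_nonconstant : ~ exists c : complex_field R,
       forall z : complex_field R, power_series_sum a z = c)
    (X_rv : forall n : nat, complex_random_variable (X n))
    (X_independent : independent_seq P X)
    (X_centred : centred_seq P X)
    (X_subgaussian : subgaussian_seq P X) :
  {ae P, forall w : T, defines_entire (fun n => a n * X n w)} /\
  (forall delta : R, 0 < delta ->
     exists (E : set R) (C : R),
       [/\ E `<=` [set r | 0 <= r], measurable E,
           finite_logarithmic_measure E, 0 < C &
           {ae P, forall w : T, exists r0 : R, 0 < r0 /\
              forall r : R, r0 <= r -> ~ E r ->
                maximum_modulus (power_series_sum (fun n => a n * X n w)) r <=
                C * maximum_term a r * ln (maximum_term a r) `^ (1 / 4)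
                  * ln (ln (maximum_term a r)) `^ (1 + delta)}]).

Proof.
have adec := entire_fast_decay f_entire.
have [n0 n0_gt0 an0_gt0] := nonconstant_coef f_nonconstant.
have growth := modulus_linear_growth X_rv X_subgaussian.
have Cw_ge0 (Cw : R) w : (forall n, modulus (X n w) <= Cw * n.+1%:R) -> 0 <= Cw.
  by move=> /(_ 0%N); rewrite mulr1; apply: le_trans; exact: modulus_ge0.
have b_le (Cw : R) w : (forall n, modulus (X n w) <= Cw * n.+1%:R) ->
    forall n, modulus (a n * X n w) <= Cw * n.+1%:R * modulus (a n).
  by move=> XC n; rewrite modulusM mulrC ler_wpM2r ?modulus_ge0.
split.
  apply: filterS growth => w [Cw XC]; apply: fast_decay_entire.
  exact: fast_decay_linear_growth adec (Cw_ge0 _ _ XC) (b_le _ _ XC).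
move=> delta d0; have u0 : 0 < 2 * delta by rewrite mulr_gt0.
pose A n := modulus (a n); pose g := log_max_term A.
have A_ge0 n : 0 <= A n := modulus_ge0 _.
have [E [E0 mE finE [x1 x10 HE]]] :=
  exceptional_set A_ge0 adec n0_gt0 an0_gt0 u0.
have [C0 C00 net] := net_event X_rv X_independent X_centred X_subgaussian.
pose B := (Num.truncn (expR (3 * (2 + 2 * delta)) : R)).+1.
have HB : expR (3 * (2 + 2 * delta)) <= B%:R :> R.
  by have /andP[_ /ltW] := truncn_itv (expR_ge0 (3 * (2 + 2 * delta)) : 0 <= _ :> R).
(* On level k, x + ln (A n0) <= g x < e^(k+1), so that x <= e^(k+1) + |ln (A n0)| <= c B^k; thus
   every radius of the level lies within reach of its net. *)
pose c := (Num.truncn (expR 1 + `|ln (A n0)| : R)).+1.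
have Hc : expR 1 + `|ln (A n0)| <= c%:R.
  by have /andP[_ /ltW] := truncn_itv (addr_ge0 (expR_ge0 1) (normr_ge0 (ln (A n0)))).
pose Xb k := (c * B ^ k)%N.
have [N HN] := choice (fun k => fast_decay_tail A_ge0 adec (expR_ge0 (Xb k)%:R)).
(* With t = tau0 sqrt k one gets t^2 / (4 C0) = k q: the Chernoff factor (2 B^4)^(-k) outweighs the
   O(B^(4k)) net points and leaves the summable 2^(-k). *)
pose q : R := ln (2 * (B ^ 4)%:R).
pose tau0 := Num.sqrt (4 * C0 * q).
have B4 : 1 <= (B ^ 4)%:R :> R by rewrite ler1n expn_gt0.
have q0 : 0 <= q by apply: ln_ge0; lra.
have t0 k : 0 <= tau0 * Num.sqrt k%:R by rewrite mulr_ge0 ?sqrtr_ge0.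
have [F HF] := choice (fun k => net (N k) a (polar_net (B ^ k) (Xb k)) _ (t0 k)).
have tailE k : expR (- ((tau0 * Num.sqrt k%:R) ^+ 2 / (4 * C0))) = (2 * (B ^ 4)%:R)^-1 ^+ k.
  rewrite exprMn !sqr_sqrtr// ?mulr_ge0// ?(ltW C00)//.
  rewrite (_ : - _ = k%:R * - q); last by field; rewrite gt_eqF.
  by rewrite expRM_natl expRN lnK// posrE; lra.
have PF k : (P (F k) <= (64 * c.+1%:R * 2^-1 ^+ k)%:E)%E.
  have [_ PFk _] := HF k; apply: (le_trans PFk); rewrite lee_fin tailE.
  have := @size_polar_net_le R c B k isT.
  rewrite -(ler_nat R) -/(Xb k) => szk.
  apply: (@le_trans _ _ ((16 * c.+1 * (B ^ 4) ^ k)%:R * (4 * (2 * (B ^ 4)%:R)^-1 ^+ k))).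
    by rewrite ler_wpM2r// mulr_ge0// exprn_ge0// invr_ge0; lra.
  have -> : (16 * c.+1 * (B ^ 4) ^ k)%:R = 16 * c.+1%:R * (B ^ 4)%:R ^+ k :> R.
    by rewrite natrM natrM [((B ^ 4) ^ k)%:R]natrX.
  have b0 : (B ^ 4)%:R ^+ k != 0 :> R by rewrite expf_neq0// gt_eqF//; lra.
  move: ((B ^ 4)%:R : R) b0 => b4 b0; rewrite !exprVn exprMn.
  have p0 : 2 ^+ k != 0 :> R by rewrite expf_neq0.
  move: (b4 ^+ k) (2 ^+ k : R) b0 p0 => b p b0 p0.
  by rewrite le_eqVlt; apply/orP; left; apply/eqP; field; rewrite b0 p0.
have bc := @borel_cantelli _ _ _ P F (fun k => 64 * c.+1%:R * 2^-1 ^+ k) (64 * c.+1%:R * 2)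
  (fun k => let: And3 mFk _ _ := HF k in mFk) PF.
have {bc} bc : {ae P, forall w, exists K, forall k, (K <= k)%N -> ~ F k w}.
  by apply: bc => M; rewrite -mulr_sumr ler_wpM2l ?mulr_ge0// sum_half_pow.
pose K : R := 1536 * expR 2.
have K0 : 0 <= K := mulr_ge0 (ler0n _ _) (expR_ge0 _).
exists E, (1 + 2 * tau0 * Num.sqrt (1 + K) * 2 `^ (1 + delta)); split => //.
  by rewrite ltr_pwDl// !mulr_ge0 ?sqrtr_ge0 ?powR_ge0.
apply: filterS2 growth bc => w [Cw XC] [K1 HK1].
have Cw0 := Cw_ge0 _ _ XC.
have [K2 K2le] : exists K2 : nat, Cw * (1 + K) <= K2%:R / 4.
  exists (Num.truncn (4 * (Cw * (1 + K)))).+1.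
  rewrite ler_pdivlMr// mulrC.
  have y0 : 0 <= 4 * (Cw * (1 + K)) by rewrite !mulr_ge0// addr_ge0.
  by have /andP[_ /ltW] := truncn_itv y0.
(* K1 comes from Borel-Cantelli and K2 from the absorption of Cw; both depend on w, and through them
   r0 does. The entry 1 makes k positive. *)
pose k0 := maxn 1 (maxn K1 K2).
pose x2 := Num.max x1 (expR k0%:R - ln (A n0)).
exists (expR x2); split; first exact: expR_gt0.
move=> r r_ge Er.
have r0 : 0 < r := lt_le_trans (expR_gt0 _) r_ge.
pose x := ln r; have rE : r = expR x by rewrite lnK.
move: Er; rewrite rE => Ex.
have x2x : x2 <= x by rewrite -ler_expR -rE.
have x1x : x1 <= x by apply: le_trans x2x; rewrite le_max lexx.
have x0 : 0 <= x := le_trans x10 x1x.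
have gx : x + ln (A n0) <= g x := log_max_term_ge adec n0_gt0 an0_gt0 x0.
have gk0 : expR k0%:R <= g x.
  apply: le_trans gx; rewrite -lerBlDr; apply: le_trans x2x.
  by rewrite le_max lexx orbT.
have g0 : 0 < g x := lt_le_trans (expR_gt0 _) gk0.
have k0ln : k0%:R <= ln (g x) by rewrite -ler_expR lnK.
have /andP[kl ku] := truncn_itv (le_trans (ler0n _ k0) k0ln).
(* The level of x, that is e^k <= g x < e^(k+1). *)
set k := Num.truncn _ in kl ku.
have k0k : (k0 <= k)%N.
  by rewrite leqNgt; apply/negP => kk0; have := lt_le_trans ku (le_trans (_ : _ <= k0%:R) k0ln);
    rewrite ltxx ler_nat => /(_ kk0).
have gk : expR k%:R <= g x by rewrite -[leRHS]lnK// ler_expR.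
have gk1 : g x < expR k.+1%:R by rewrite -[ltLHS]lnK// ltr_expR.
have [G1 G2] := HE k x x1x gk1 Ex.
have k1 : (0 < k)%N by apply: leq_trans k0k; rewrite leq_max.
have K1k : (K1 <= k)%N by apply: leq_trans k0k; rewrite !leq_max leqnn orbT.
have K2k : (K2 <= k)%N by apply: leq_trans k0k; rewrite !leq_max leqnn !orbT.
have xX : x <= (Xb k)%:R.
  have eB : expR k%:R <= (B ^ k)%:R :> R.
    rewrite natrX -[k%:R]mulr1 expRM_natl lerXn2r ?nnegrE ?expR_ge0//.
    by apply: le_trans HB; rewrite ler_expR; clear -d0; lra.
  have B1 : 1 <= (B ^ k)%:R :> R by rewrite ler1n expn_gt0.
  apply: (@le_trans _ _ (expR 1 * expR k%:R + `|ln (A n0)|)).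
    have : - ln (A n0) <= `|ln (A n0)| by rewrite -normrN ler_norm.
    rewrite -expRD [1 + _]addrC natr1; move: gx (ltW gk1); rewrite /g.
    move: (ln (A n0)) (log_max_term A x) (expR _) => p1 p2 p3; clear; lra.
  rewrite /Xb natrM; apply: (@le_trans _ _ ((expR 1 + `|ln (A n0)|) * (B ^ k)%:R)).
    by rewrite mulrDl lerD// ?ler_wpM2l ?expR_ge0// ler_peMr.
  by rewrite ler_wpM2r.
have CwK : Cw * (1 + K) <= expR (k%:R / 4).
  apply: (le_trans K2le); apply: (@le_trans _ _ (k%:R / 4)).
    by rewrite ler_pM2r ?invr_gt0// ler_nat.
  by apply: le_trans (expR_ge1Dx _); rewrite lerDr.
have muE : maximum_term a (expR x) = expR (g x) := max_termE adec an0_gt0 x.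
rewrite muE expRK.
apply: le_trans (final_estimate d0 k1 Cw0 (sqrtr_ge0 _) K0 gk CwK).
apply: ge_sup.
  exists (modulus (power_series_sum (fun n => a n * X n w) (to_complex (expR x)))).
  exists (to_complex (expR x)) => //.
  by rewrite /mkset modulus_to_complex gtr0_norm ?expR_gt0.
move=> _ [z /= zx <-].
apply: (level_bound adec an0_gt0 u0 Cw0 (b_le _ _ XC) HB x0 xX (t0 k) G1 G2 (HN k)) => //.
move=> w' w's; have [_ _ HFk] := HF k.
exact: HFk (HK1 k K1k) _ w's.
Qed.
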